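(* Let $S$ be the unit sphere of $\mathbb{C}^n$. Suppose $\Omega\subset Q$ is an $L^\infty(S)$-algebra pattern such that $p\ge q$ for every $(p,q)\in\Omega$ and $(a,a)\in\Omega$ for some $a>0$. (1) If $n\ge 3$, then $\Omega=G(\Sigma)$ for some (possibly empty) additive semigroup $\Sigma$ of positive integers. (2) If $n=2$, and if for a (possibly empty) additive semigroup $\Sigma$ of positive integers $G^*(\Sigma)$ denotes the set obtained from $G(\Sigma)$ by deleting all $(m,m)$ with $m$ odd, then $G^*(\Sigma)$ is also an $L^\infty(S)$-algebra pattern, and $\Omega$ is either $G(\Sigma)$ or $G^*(\Sigma)$ for some such $\Sigma$.
   Context: $\sigma$ is the unique rotation-invariant (i.e. $O(2n)$-invariant) Borel probability measure on $S$, and $L^p(S)=L^p(S,\sigma)$ (complex-valued). The weak*-topology on $L^\infty(S)$ is the one it carries as the dual of $L^1(S)$, via the functionals $f\mapsto\int_S fg\,d\sigma$, $g\in L^1(S)$. $Q$ is the set of pairs $(p,q)$ of nonnegative integers. For $(p,q)\in Q$, $H(p,q)$ is the space of restrictions to $S$ of harmonic polynomials on $\mathbb{C}^n$ that are homogeneous of degree $p$ in $z_1,\dots,z_n$ and homogeneous of degree $q$ in $\bar z_1,\dots,\bar z_n$. For $\Omega\subset Q$, $E_\Omega$ is the set of all finite sums of elements of the spaces $H(p,q)$ with $(p,q)\in\Omega$, and $\overline{E}_\Omega^{*}$ is its weak*-closure in $L^\infty(S)$. $\Omega$ is an $L^\infty(S)$-algebra pattern if $\overline{E}_\Omega^{*}$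 is an algebra, i.e. a linear subspace closed under pointwise multiplication (it need not contain the constants). For an integer $k$, $\Delta_k=\{(p,q)\in Q:p-q=k\}$. For a (possibly empty) additive semigroup $\Sigma$ of positive integers (a set of positive integers closed under addition), $G(\Sigma)$ is the union of $\Delta_0$ and all $\Delta_k$ with $k\in\Sigma$. *)

(* Defs.v *)
From HB Require Import structures.
From mathcomp Require Import all_boot all_order all_algebra.
From mathcomp Require Import all_classical all_reals all_analysis.
From mathcomp Require Import complex.
From mathcomp Require mpoly.

Set Implicit Arguments.
Unset Strict Implicit.
Unset Printing Implicit Defensive.

Import Order.TTheory GRing.Theory Num.Theory.
Import numFieldNormedType.Exports.
(* The notations of mpoly clash with those of MathComp-Analysis. *)
Import -(notations) mpoly.

Local Open Scope classical_set_scope.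
Local Open Scope ring_scope.
Local Open Scope complex_scope.

(** Complex [L^p] spaces.  As sets of honest functions: two functions that
    agree almost everywhere are distinct elements of [cLp], but
    [weak_star_topology] does not separate them, so weak*-closed sets are
    saturated for almost everywhere equality. *)

Section complex_Lp.
Context {d : measure_display} {T : measurableType d} {R : realType}.
Variable mu : {measure set T -> \bar R}.

Definition cmeasurable (f : T -> R[i]) : Prop :=
  measurable_fun [set: T] (@complex.Re R \o f) /\
  measurable_fun [set: T] (@complex.Im R \o f).

Definition cLp (p : \bar R) : set (T -> R[i]) :=
  [set f | cmeasurable f /\
           finite_norm mu p (@ComplexField.Normc.normc R \o f)].

Definition cintegral (f : T -> R[i]) : R[i] :=
  (\int[mu]_x complex.Re (f x))%R +i* (\int[mu]_x complex.Im (f x))%R.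

Definition dual_pairing (f : cLp +oo%E) : {ptws cLp 1%E -> (R[i])^o} :=
  fun g => cintegral (set_val f \* set_val g).

Definition weak_star_topology := initial_topology dual_pairing.

Definition weak_star_closure (E : set (T -> R[i])) : set (T -> R[i]) :=
  set_val @` closure ([set f | E (set_val f)] : set weak_star_topology).

End complex_Lp.

Definition is_function_algebra {T : Type} {R : realType}
    (A : set (T -> R[i])) : Prop :=
  [/\ A (fun=> 0),
      (forall f g, A f -> A g -> A (fun x => f x + g x)),
      (forall (c : R[i]) f, A f -> A (fun x => c * f x)) &
      (forall f g, A f -> A g -> A (fun x => f x * g x))].

(** The unit sphere of [C^n], [n = m.+1].  Measurable types are pointed in
    MathComp-Analysis, hence the exclusion of dimension [0]. *)

Section sphere.
Variables (R : realType) (m : nat).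

(* [R[i]] carries its topology only through the alias [R[i]^o]. *)
Local Notation Cn := 'rV[(R[i])^o]_m.+1.

Definition sqnorm (z : Cn) : R[i] :=
  \sum_(j < m.+1) `|z ord0 j : R[i]| ^+ 2.

Definition unit_sphere : set Cn := [set z | sqnorm z = 1].

Definition sphere : Type := set_type unit_sphere.

HB.instance Definition _ := Topological.on sphere.

Lemma sphere_point_subproof : unit_sphere (delta_mx ord0 ord0).
Proof.
rewrite /unit_sphere /= /sqnorm (bigD1 ord0) //= big1 ?addr0.
  by rewrite mxE !eqxx /= normr1 expr1n.
by move=> j jN0; rewrite mxE (negbTE jN0) andbF normr0 expr0n.
Qed.

HB.instance Definition _ :=
  isPointed.Build sphere (SigSub (mem_set sphere_point_subproof)).

Definition borel_sphere := g_sigma_algebraType (@open sphere).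

(** [O(2n)]: the real-linear isometries of [C^n = R^(2n)]. *)
Definition orthogonal_map (U : Cn -> Cn) :=
  [/\ (forall z w, U (z + w) = U z + U w),
      (forall (t : R) z, U (t%:C *: z) = t%:C *: U z) &
      (forall z, sqnorm (U z) = sqnorm z)].

Definition rotation_invariant (sigma : probability borel_sphere R) : Prop :=
  forall U, orthogonal_map U -> forall A : set borel_sphere, measurable A ->
    sigma [set z | exists2 w, A w & set_val z = U (set_val w)] = sigma A.

Definition second_derivative_along (u : Cn -> R) (v z : Cn) : R :=
  derive1n 2 (fun t : R => u (z + t%:C *: v) : R^o) 0.

Definition laplacian (u : Cn -> R) z : R :=
  \sum_(j < m.+1)
    (second_derivative_along u (delta_mx ord0 j) z +
     second_derivative_along u ((0 +i* 1) *: delta_mx ord0 j) z).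

Definition harmonic (f : Cn -> R[i]) : Prop :=
  forall z, laplacian (@complex.Re R \o f) z = 0 /\
            laplacian (@complex.Im R \o f) z = 0.

(** Polynomials in [z] and its conjugate: the first [n] indeterminates stand for
    the [z_j], the last [n] for their conjugates. *)
Definition eval_zzbar (P : mpoly (m.+1 + m.+1) R[i]) (z : Cn) : R[i] :=
  meval (fun k : 'I_(m.+1 + m.+1) =>
           match fintype.split k return R[i] with
           | inl j => z ord0 j : R[i]
           | inr j => (z ord0 j : R[i])^*
           end) P.

Definition bihomogeneous (p q : nat) (P : mpoly (m.+1 + m.+1) R[i]) :=
  forall a, a \in msupp P ->
    (\sum_(j < m.+1) a (lshift m.+1 j))%N = p /\
    (\sum_(j < m.+1) a (rshift m.+1 j))%N = q.

Definition Hpq (p q : nat) : set (sphere -> R[i]) :=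
  [set f | exists P, [/\ bihomogeneous p q P, harmonic (eval_zzbar P) &
                         forall z, f z = eval_zzbar P (set_val z)]].

Definition E_ (Omega : set (nat * nat)) : set (sphere -> R[i]) :=
  [set f | exists (k : nat) (h : 'I_k -> sphere -> R[i]),
     (forall i, exists2 w, Omega w & Hpq w.1 w.2 (h i)) /\
     (forall z, f z = \sum_(i < k) h i z)].

Definition Linfty_algebra_pattern (sigma : probability borel_sphere R)
    (Omega : set (nat * nat)) : Prop :=
  is_function_algebra (weak_star_closure sigma (E_ Omega)).

End sphere.

Definition Delta (k : int) : set (nat * nat) :=
  [set w | w.1%:Z - w.2%:Z = k].

Definition additive_semigroup (Sigma : set nat) : Prop :=
  (forall k, Sigma k -> (0 < k)%N) /\
  (forall k l, Sigma k -> Sigma l -> Sigma (k + l)%N).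

Definition G (Sigma : set nat) : set (nat * nat) :=
  Delta 0 `|` \bigcup_(k in Sigma) Delta k%:Z.

Definition Gstar (Sigma : set nat) : set (nat * nat) :=
  G Sigma `\` [set w | exists2 k, odd k & w = (k, k)].

(* Main.v *)
Require Import Defs.
From mathcomp Require Import all_boot all_order all_algebra.
From mathcomp Require Import all_classical all_reals all_analysis.
From mathcomp Require Import complex measurable_realfun ess_sup_inf.
From mathcomp Require Import ring zify.
From mathcomp Require mpoly.

(** Write [H_{pq}] for [H(p, q)].  Since multiplication by a bounded function is
    weak*-continuous and distinct [H_{pq}] are orthogonal, [Omega] is an algebra
    pattern exactly when [H_{pq} H_{rs}] lies in [E_Omega] for all [(p, q)] and
    [(r, s)] in [Omega].  To show that [(k, l)] is forced into [Omega] it is thus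
    enough to exhibit [f] in [H_{pq}] and [g] in [H_{rs}] with a nonzero integral
    of [f g conj h], where [h = z_1^k conj(z_2)^l].  Monomials do this when
    [n >= 3]: they lead from [(a, a)] to [(1, 1)], and then up and down each
    diagonal.  When [n = 2] there are not enough monomials, and one also uses
    [z_1^b conj(z_2)^b (|z_1|^2 - |z_2|^2)], which belongs to [H_{b+1,b+1}]; it
    leads from [(a, a)] to [(2, 2)] and moves by one step along every diagonal
    but the main one.

    Write [L P] for the integral of [P] over the sphere.  Invariance gives
    [L(z_j d_k P) = L(w_k e_j P)] where [w = conj z], [d = d/dz], [e = d/dw], and
    hence, for [P] of bidegree [(p, q)], the mean value identity
    [L(Laplacian P) = q (n + q - 1) L(P)], from which orthogonality and all the
    moments follow.

    When [n = 2] the map [(z_1, z_2) -> (-conj z_2, conj z_1)], which covers the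
    antipode of the Riemann sphere, acts on [H_{mm}] by [(-1)^m].  Products of two
    even harmonics therefore have even components only, so that removing the odd
    [(m, m)] leaves an algebra. *)

Set Implicit Arguments.
Unset Strict Implicit.
Unset Printing Implicit Defensive.

Import Order.TTheory GRing.Theory Num.Theory.
Import numFieldNormedType.Exports.
Import -(notations) mpoly.

Local Open Scope ring_scope.

(** * Bihomogeneous polynomials *)

Lemma mpoly_ring_ind (n : nat) (K : comNzRingType) (Pr : mpoly n K -> Prop) :
  (forall c, Pr (mpolyC n c)) -> (forall i, Pr (mpolyX K (mnm1 i))) ->
  (forall p q, Pr p -> Pr q -> Pr (p + q)) ->
  (forall p q, Pr p -> Pr q -> Pr (p * q)) ->
  forall p, Pr p.
Proof.
move=> PC PX PD PM; elim/mpolyind => [|c a p _ _ Pp].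
  by have := PC 0; rewrite mpolyC0.
apply: (PD) Pp; rewrite -mul_mpolyC; apply: (PM) => //.
rewrite mpolyXE_id; elim/big_ind: _ => // [|i _].
  by have := PC 1; rewrite mpolyC1.
by elim: (a i) => [|k IH]; [rewrite expr0 -mpolyC1|rewrite exprS; apply: PM].
Qed.

Section bihomogeneous_polynomials.
Variables (K : numFieldType) (N : nat).
Local Notation mp := (mpoly (N + N) K).
Implicit Types (P Q F : mp) (a b : multinom (N + N)).

(* [zv j] and [wv j] stand for [z_j] and its conjugate. *)
Definition zv (j : 'I_N) : mp := mpolyX K (mnm1 (lshift N j)).
Definition wv (j : 'I_N) : mp := mpolyX K (mnm1 (rshift N j)).
Definition dz (j : 'I_N) P : mp := mderiv (lshift N j) P.
Definition dw (j : 'I_N) P : mp := mderiv (rshift N j) P.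
Definition sqr_radius : mp := \sum_j zv j * wv j.
Definition lap P : mp := \sum_j dz j (dw j P).
Local Notation r := sqr_radius.

Definition degz a := (\sum_(j < N) a (lshift N j))%N.
Definition degw a := (\sum_(j < N) a (rshift N j))%N.
Definition bihom (p q : nat) P :=
  forall a, a \in msupp P -> degz a = p /\ degw a = q.

Lemma degzD a b : degz (mnm_add a b) = (degz a + degz b)%N.
Proof. by rewrite /degz -big_split; apply: eq_bigr => j _; rewrite mnmDE. Qed.

Lemma degwD a b : degw (mnm_add a b) = (degw a + degw b)%N.
Proof. by rewrite /degw -big_split; apply: eq_bigr => j _; rewrite mnmDE. Qed.

Lemma degz_lshift j : degz (mnm1 (lshift N j)) = 1%N.
Proof.
rewrite /degz (bigD1 j) //= mnm1E eqxx big1 // => k kj.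
by rewrite mnm1E (inj_eq (@lshift_inj _ _)) eq_sym (negbTE kj).
Qed.

Lemma degz_rshift j : degz (mnm1 (rshift N j)) = 0%N.
Proof. by rewrite /degz big1 // => k _; rewrite mnm1E eq_rlshift. Qed.

Lemma degw_rshift j : degw (mnm1 (rshift N j)) = 1%N.
Proof.
rewrite /degw (bigD1 j) //= mnm1E eqxx big1 // => k kj.
by rewrite mnm1E (inj_eq (@rshift_inj _ _)) eq_sym (negbTE kj).
Qed.

Lemma degw_lshift j : degw (mnm1 (lshift N j)) = 0%N.
Proof. by rewrite /degw big1 // => k _; rewrite mnm1E eq_lrshift. Qed.

Lemma deg_eq0 a : degz a = 0%N -> degw a = 0%N -> a = mnm0.
Proof.
move=> az aw; apply/mnmP => k; rewrite mnm0E -(splitK k).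
case: (fintype.split k) => l; apply/eqP; rewrite -leqn0 /=.
  have : (a (lshift N l) <= degz a)%N by rewrite /degz (bigD1 l) //= leq_addr.
  by rewrite az.
have : (a (rshift N l) <= degw a)%N by rewrite /degw (bigD1 l) //= leq_addr.
by rewrite aw.
Qed.

Lemma bihom0 p q : bihom p q 0.
Proof. by move=> a; rewrite msupp0. Qed.

Lemma bihomX a : bihom (degz a) (degw a) (mpolyX K a).
Proof. by move=> b; rewrite msuppX inE => /eqP ->. Qed.

Lemma bihomD p q P Q : bihom p q P -> bihom p q Q -> bihom p q (P + Q).
Proof.
by move=> hP hQ a /msuppD_le; rewrite mem_cat => /orP[/hP|/hQ].
Qed.

Lemma bihomZ p q c P : bihom p q P -> bihom p q (c *: P).
Proof. by move=> hP a /msuppZ_le /hP. Qed.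

Lemma bihomN p q P : bihom p q P -> bihom p q (- P).
Proof. by rewrite -scaleN1r; apply: bihomZ. Qed.

Lemma bihomB p q P Q : bihom p q P -> bihom p q Q -> bihom p q (P - Q).
Proof. by move=> hP hQ; apply: bihomD => //; apply: bihomN. Qed.

Lemma bihom_sum p q (I : Type) (s : seq I) (Pr : pred I) (F : I -> mp) :
  (forall i, Pr i -> bihom p q (F i)) -> bihom p q (\sum_(i <- s | Pr i) F i).
Proof. by move=> hF; elim/big_ind: _ => //; [exact: bihom0|exact: bihomD]. Qed.

Lemma bihomM p q p' q' P Q :
  bihom p q P -> bihom p' q' Q -> bihom (p + p') (q + q') (P * Q).
Proof.
move=> hP hQ a /msuppM_le /allpairsP[[b c] /= [/hP[<- <-] /hQ[<- <-] ->]].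
by rewrite degzD degwD.
Qed.

Lemma bihomC c : bihom 0 0 (mpolyC (N + N) c).
Proof.
move=> a; rewrite msuppC; case: ifP => // _; rewrite inE => /eqP ->.
by rewrite /degz /degw !big1 // => j _; rewrite mnm0E.
Qed.

Lemma bihom_nat k : bihom 0 0 k%:R.
Proof. by rewrite -mpolyC_nat; apply: bihomC. Qed.

Lemma bihom_zv j : bihom 1 0 (zv j).
Proof. by have := @bihomX (mnm1 (lshift N j)); rewrite degz_lshift degw_lshift. Qed.

Lemma bihom_wv j : bihom 0 1 (wv j).
Proof. by have := @bihomX (mnm1 (rshift N j)); rewrite degz_rshift degw_rshift. Qed.

Lemma bihomXn p q P k : bihom p q P -> bihom (p * k) (q * k) (P ^+ k).
Proof.
move=> hP; elim: k => [|k IH]; first by rewrite !muln0 expr0; apply: bihomC.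
by rewrite exprS !mulnS; apply: bihomM.
Qed.

Lemma bihom_sqr_radius : bihom 1 1 r.
Proof.
by apply: bihom_sum => j _; apply: (@bihomM 1 0 0 1); [apply: bihom_zv|apply: bihom_wv].
Qed.

Lemma bihom_dz p q j P : bihom p q P -> bihom p.-1 q (dz j P).
Proof.
move=> hP a; rewrite mcoeff_msupp mcoeff_mderiv => na.
have /hP : mnm_add a (mnm1 (lshift N j)) \in msupp P.
  by rewrite mcoeff_msupp; apply: contraNneq na => ->; rewrite mul0rn.
by rewrite degzD degwD degz_lshift degw_lshift addn1 addn0 => -[<- <-].
Qed.

Lemma bihom_dw p q j P : bihom p q P -> bihom p q.-1 (dw j P).
Proof.
move=> hP a; rewrite mcoeff_msupp mcoeff_mderiv => na.
have /hP : mnm_add a (mnm1 (rshift N j)) \in msupp P.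
  by rewrite mcoeff_msupp; apply: contraNneq na => ->; rewrite mul0rn.
by rewrite degzD degwD degz_rshift degw_rshift addn1 addn0 => -[<- <-].
Qed.

Lemma bihom0_dz q j P : bihom 0 q P -> dz j P = 0.
Proof.
move=> hP; apply/mpolyP => a; rewrite mcoeff0 mcoeff_mderiv.
case: (boolP (mnm_add a (mnm1 (lshift N j)) \in msupp P)) => [/hP|].
  by rewrite degzD degz_lshift addn1 => -[].
by rewrite mcoeff_msupp negbK => /eqP ->; rewrite mul0rn.
Qed.

Lemma bihom0_dw p j P : bihom p 0 P -> dw j P = 0.
Proof.
move=> hP; apply/mpolyP => a; rewrite mcoeff0 mcoeff_mderiv.
case: (boolP (mnm_add a (mnm1 (rshift N j)) \in msupp P)) => [/hP|].
  by rewrite degwD degw_rshift addn1 => -[].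
by rewrite mcoeff_msupp negbK => /eqP ->; rewrite mul0rn.
Qed.

Lemma bihom_ind p q (Pr : mp -> Prop) :
  Pr 0 -> (forall c P Q, Pr P -> Pr Q -> Pr (c *: P + Q)) ->
  (forall a, degz a = p -> degw a = q -> Pr (mpolyX K a)) ->
  forall P, bihom p q P -> Pr P.
Proof.
move=> P0 PD PX P hP; rewrite [P]mpolyE big_seq.
elim/big_rec: _ => // a Q /hP[pa qa] PQ.
by apply: PD => //; apply: PX.
Qed.

Lemma mulX_mderiv i a :
  mpolyX K (mnm1 i) * mderiv i (mpolyX K a) = (a i)%:R * mpolyX K a
  :> mp.
Proof.
rewrite mderivX -scalerAr scaler_nat mulr_natl; case: (posnP (a i)) => [->|ai].
  by rewrite !mulr0n.
congr (_ *+ _); rewrite -mpolyXD addmC submK //; apply/mnm_lepP => j.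
by rewrite mnm1E; case: eqP => // <-.
Qed.

Lemma euler_z p q P : bihom p q P -> \sum_j zv j * dz j P = p%:R * P.
Proof.
elim/bihom_ind => {P} [|c P Q IP IQ|a <- _].
- by rewrite mulr0 big1 // => j _; rewrite /dz mderiv0 mulr0.
- rewrite mulrDr -scalerAr -IP -IQ scaler_sumr -big_split.
  by apply: eq_bigr => j _; rewrite /dz mderivD mderivZ mulrDr scalerAr.
- rewrite natr_sum mulr_suml; apply: eq_bigr => j _.
  exact: mulX_mderiv.
Qed.

Lemma euler_w p q P : bihom p q P -> \sum_j wv j * dw j P = q%:R * P.
Proof.
elim/bihom_ind => {P} [|c P Q IP IQ|a _ <-].
- by rewrite mulr0 big1 // => j _; rewrite /dw mderiv0 mulr0.
- rewrite mulrDr -scalerAr -IP -IQ scaler_sumr -big_split.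
  by apply: eq_bigr => j _; rewrite /dw mderivD mderivZ mulrDr scalerAr.
- rewrite natr_sum mulr_suml; apply: eq_bigr => j _.
  exact: mulX_mderiv.
Qed.

Lemma dzD j P Q : dz j (P + Q) = dz j P + dz j Q. Proof. exact: mderivD. Qed.
Lemma dwD j P Q : dw j (P + Q) = dw j P + dw j Q. Proof. exact: mderivD. Qed.
Lemma dzM j P Q : dz j (P * Q) = dz j P * Q + P * dz j Q.
Proof. exact: mderivM. Qed.
Lemma dwM j P Q : dw j (P * Q) = dw j P * Q + P * dw j Q.
Proof. exact: mderivM. Qed.

Lemma mderivU i k : mderiv i (mpolyX K (mnm1 k)) = (i == k)%:R :> mp.
Proof.
rewrite mderivX mnm1E eq_sym; case: eqP => [->|_]; last by rewrite scale0r.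
by rewrite scale1r -[X in mnm_sub X _]addm0 addmC addmK mpolyX0.
Qed.

Lemma dz_zv j k : dz j (zv k) = (j == k)%:R.
Proof. by rewrite /dz mderivU (inj_eq (@lshift_inj _ _)). Qed.
Lemma dw_wv j k : dw j (wv k) = (j == k)%:R.
Proof. by rewrite /dw mderivU (inj_eq (@rshift_inj _ _)). Qed.
Lemma dz_wv j k : dz j (wv k) = 0.
Proof. by rewrite /dz mderivU eq_lrshift. Qed.
Lemma dw_zv j k : dw j (zv k) = 0.
Proof. by rewrite /dw mderivU eq_rlshift. Qed.

Definition mderiv_along (u w : 'I_N -> mp) P : mp :=
  \sum_j (u j * dz j P + w j * dw j P).

Lemma mderiv_alongD u w P Q :
  mderiv_along u w (P + Q) = mderiv_along u w P + mderiv_along u w Q.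
Proof.
rewrite -big_split; apply: eq_bigr => j _ /=.
by rewrite dzD dwD !mulrDr addrACA.
Qed.

Lemma mderiv_alongM u w P Q :
  mderiv_along u w (P * Q) = mderiv_along u w P * Q + P * mderiv_along u w Q.
Proof.
rewrite mulr_suml mulr_sumr -big_split; apply: eq_bigr => j _ /=.
by rewrite dzM dwM; ring.
Qed.

Lemma mderiv_alongC u w c : mderiv_along u w (mpolyC _ c) = 0.
Proof.
by rewrite /mderiv_along big1 // => j _; rewrite /dz /dw !mderivC !mulr0 addr0.
Qed.

Lemma mderiv_along_delta u w (j : 'I_N) c d P :
  (forall k, u k = mpolyC _ (if k == j then c else 0)) ->
  (forall k, w k = mpolyC _ (if k == j then d else 0)) ->
  mderiv_along u w P = c *: dz j P + d *: dw j P.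
Proof.
move=> hu hw; rewrite /mderiv_along (bigD1 j) //= big1 ?addr0 => [|k kj].
  by rewrite hu hw eqxx !mul_mpolyC.
by rewrite hu hw (negbTE kj) mpolyC0 !mul0r addr0.
Qed.

Lemma mderiv_along_zv u w j : mderiv_along u w (zv j) = u j.
Proof.
rewrite /mderiv_along (bigD1 j) //= big1 ?addr0 => [|k kj].
  by rewrite dz_zv dw_zv eqxx mulr0 addr0 mulr1.
by rewrite dz_zv dw_zv (negbTE kj) !mulr0 addr0.
Qed.

Lemma mderiv_along_wv u w j : mderiv_along u w (wv j) = w j.
Proof.
rewrite /mderiv_along (bigD1 j) //= big1 ?addr0 => [|k kj].
  by rewrite dz_wv dw_wv eqxx mulr0 add0r mulr1.
by rewrite dz_wv dw_wv (negbTE kj) !mulr0 addr0.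
Qed.

Lemma second_mderiv_pair (c : K) j P : c * c = -1 ->
  dz j (dz j P + dw j P) + dw j (dz j P + dw j P) +
  (c *: dz j (c *: dz j P + (- c) *: dw j P)
   + (- c) *: dw j (c *: dz j P + (- c) *: dw j P)) = dz j (dw j P) *+ 4.
Proof.
move=> cc; rewrite /dz /dw !mderivD !mderivZ !scalerDr !scalerA.
rewrite !(mulrN, mulNr) !cc !opprK !scaleN1r !scale1r.
rewrite (mderiv_comm (rshift N j) (lshift N j)).
by move: (mderiv _ (mderiv _ _)) (mderiv _ (mderiv _ _)) (mderiv _ (mderiv _ _))
  => x y z; ring.
Qed.

Lemma sum_delta (F : 'I_N -> mp) j : \sum_k (j == k)%:R * F k = F j.
Proof.
rewrite (bigD1 j) //= eqxx mul1r big1 ?addr0 // => k kj.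
by rewrite eq_sym (negbTE kj) mul0r.
Qed.

Lemma dz_sqr_radius j : dz j r = wv j.
Proof.
rewrite /dz /sqr_radius (raddf_sum (mderiv (lshift N j))) /= -(sum_delta wv).
by apply: eq_bigr => k _; rewrite -/(dz _ _) dzM dz_zv dz_wv mulr0 addr0.
Qed.

Lemma dw_sqr_radius j : dw j r = zv j.
Proof.
rewrite /dw /sqr_radius (raddf_sum (mderiv (rshift N j))) /= -(sum_delta zv).
apply: eq_bigr => k _; rewrite -/(dw _ _) dwM dw_wv dw_zv mul0r add0r.
by rewrite mulrC.
Qed.

Lemma lap0 : lap 0 = 0.
Proof. by rewrite /lap big1 // => j _; rewrite /dz /dw !mderiv0. Qed.

Lemma lapD P Q : lap (P + Q) = lap P + lap Q.
Proof. by rewrite -big_split; apply: eq_bigr => j _; rewrite dwD dzD. Qed.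

Lemma lapZ c P : lap (c *: P) = c *: lap P.
Proof.
by rewrite scaler_sumr; apply: eq_bigr => j _; rewrite /dw /dz !mderivZ.
Qed.

Lemma lap_natM c P : lap (c%:R * P) = c%:R * lap P.
Proof.
rewrite !mulr_natl; elim: c => [|c IH]; first by rewrite !mulr0n lap0.
by rewrite !mulrS lapD IH.
Qed.

Lemma lapN P : lap (- P) = - lap P.
Proof. by rewrite -scaleN1r lapZ scaleN1r. Qed.

Lemma lapB P Q : lap (P - Q) = lap P - lap Q.
Proof. by rewrite lapD lapN. Qed.

Lemma lapM P Q : lap (P * Q) = lap P * Q + P * lap Q +
  \sum_j (dz j P * dw j Q + dw j P * dz j Q).
Proof.
rewrite /lap mulr_suml mulr_sumr -!big_split; apply: eq_bigr => j _ /=.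
by rewrite dwM dzD !dzM; ring.
Qed.

Lemma bihom_lap p q P : bihom p q P -> bihom p.-1 q.-1 (lap P).
Proof. by move=> hP; apply: bihom_sum => j _; apply/bihom_dz/bihom_dw. Qed.

Lemma lap_bihom0z q P : bihom 0 q P -> lap P = 0.
Proof.
by move=> hP; rewrite /lap big1 // => j _; apply: bihom0_dz (bihom_dw (j := j) hP).
Qed.

Lemma lap_bihom0w p P : bihom p 0 P -> lap P = 0.
Proof.
move=> hP; rewrite /lap big1 // => j _; rewrite (bihom0_dw _ hP).
by rewrite /dz mderiv0.
Qed.

Lemma lap_sqr_radiusM p q Q : bihom p q Q ->
  lap (r * Q) = r * lap Q + (N + p + q)%:R * Q.
Proof.
move=> hQ; rewrite lapM !natrD !mulrDl -(euler_z hQ) -(euler_w hQ) big_split /=.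
have -> : lap r = N%:R.
  rewrite /lap (eq_bigr (fun=> 1)) => [|j _].
    by rewrite sumr_const card_ord.
  by rewrite dw_sqr_radius dz_zv eqxx.
rewrite (eq_bigr (fun j => wv j * dw j Q)) => [|j _]; last first.
  by rewrite dz_sqr_radius.
rewrite [X in _ + (_ + X)](eq_bigr (fun j => zv j * dz j Q)) => [|j _].
  by ring.
by rewrite dw_sqr_radius.
Qed.

Lemma solve_radial_lap p q c W : (0 < c)%N -> bihom p q W ->
  exists2 Q, bihom p q Q & r * lap Q + c%:R * Q = W.
Proof.
have inv (d : nat) P : (0 < d)%N -> d%:R * ((d%:R : K)^-1 *: P) = P.
  by move=> d0; rewrite mulr_natl -scaler_nat scalerA divff ?scale1r // pnatr_eq0 -lt0n.
elim: p q c W => [|p IH] q c W c0 hW.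
  exists ((c%:R : K)^-1 *: W); first exact: bihomZ.
  by rewrite lapZ (lap_bihom0z hW) scaler0 mulr0 add0r inv.
case: q hW => [|q] hW.
  exists ((c%:R : K)^-1 *: W); first exact: bihomZ.
  by rewrite lapZ (lap_bihom0w hW) scaler0 mulr0 add0r inv.
(* The equation of [Y] is the Laplacian of that of [Q], with [Y = lap Q]. *)
have [||Y hY eY] := IH q (c + (N + p + q))%N (lap W); first by lia.
  exact: bihom_lap hW.
exists ((c%:R : K)^-1 *: (W - r * Y)).
  by apply/bihomZ/bihomB => //; apply: (bihomM bihom_sqr_radius).
have -> : lap ((c%:R : K)^-1 *: (W - r * Y)) = Y.
  rewrite lapZ lapB (lap_sqr_radiusM hY) -eY natrD mulrDl.
  rewrite (_ : _ - _ = c%:R * Y); last by ring.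
  by rewrite scalerAr inv.
by rewrite inv // addrC subrK.
Qed.

Lemma radial_lap_inj p q c Q : (0 < c)%N -> bihom p q Q ->
  r * lap Q + c%:R * Q = 0 -> Q = 0.
Proof.
have tors (d : nat) P : (0 < d)%N -> d%:R * P = 0 -> P = 0.
  move=> d0 /eqP; rewrite mulf_eq0 -mpolyC_nat mpolyC_eq0 pnatr_eq0.
  by case/orP=> [|/eqP//]; lia.
elim: p q c Q => [|p IH] q c Q c0 hQ.
  by rewrite (lap_bihom0z hQ) mulr0 add0r; apply: tors.
case: q hQ => [|q] hQ; first by rewrite (lap_bihom0w hQ) mulr0 add0r; apply: tors.
move=> e; have hL := bihom_lap hQ.
have lapQ0 : lap Q = 0.
  apply: (IH q (c + (N + p + q))%N _ _ hL); first by lia.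
  have : lap (r * lap Q + c%:R * Q) = 0 by rewrite e lap0.
  by rewrite lapD (lap_sqr_radiusM hL) lap_natM natrD mulrDl /= => <-; ring.
by move: e; rewrite lapQ0 mulr0 add0r; apply: tors.
Qed.

Lemma harmonic_sqr_radiusM_eq0 p q Q : (0 < N)%N -> bihom p q Q ->
  lap (r * Q) = 0 -> Q = 0.
Proof.
move=> N0 hQ; rewrite (lap_sqr_radiusM hQ); apply: radial_lap_inj hQ.
by lia.
Qed.

Lemma harmonic_decomposition p q P : (0 < N)%N -> bihom p q P ->
  exists h : nat -> mp,
    (forall j, (j <= minn p q)%N -> bihom (p - j) (q - j) (h j) /\ lap (h j) = 0)
    /\ P = \sum_(j < (minn p q).+1) r ^+ j * h j.
Proof.
move=> N0; elim: p q P => [|p IH] q P hP.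
  exists (fun=> P); rewrite min0n big_ord1 expr0 mul1r; split => // j.
  by rewrite leqn0 => /eqP ->; rewrite !subn0 (lap_bihom0z hP).
case: q hP => [|q] hP.
  exists (fun=> P); rewrite minn0 big_ord1 expr0 mul1r; split => // j.
  by rewrite leqn0 => /eqP ->; rewrite !subn0 (lap_bihom0w hP).
have [|Q hQ eQ] := @solve_radial_lap p q (N + p + q) (lap P) _ (bihom_lap hP).
  by lia.
have [h [hh eh]] := IH q Q hQ.
exists (fun j => if j is k.+1 then h k else P - r * Q); split.
  case=> [|j]; rewrite ?minnSS ?ltnS ?subn0 ?subSS => jp; last exact: hh.
  split; first by apply: bihomB => //; apply: (bihomM bihom_sqr_radius).
  by rewrite lapB (lap_sqr_radiusM hQ) eQ subrr.
rewrite minnSS big_ord_recl expr0 mul1r [X in r * X]eh mulr_sumr.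
rewrite [X in _ + X](eq_bigr (fun j : 'I_(minn p q).+1 => r * (r ^+ j * h j))).
  by rewrite subrK.
by move=> j _ /=; rewrite /bump add1n exprS mulrA.
Qed.

End bihomogeneous_polynomials.

(** * The antipodal symmetry in dimension two *)

Section antipodal_symmetry.
Variable K : numFieldType.
Local Notation mp := (mpoly (2 + 2) K).
Implicit Types (P Q F : mp).
Local Notation r := (sqr_radius K 2).

Definition asign (j : 'I_2) : mp := if j == ord0 then -1 else 1.

Definition antipodal_subst (k : 'I_(2 + 2)) : mp :=
  match fintype.split k with
  | inl j => asign j * wv K (rev_ord j)
  | inr j => asign j * zv K (rev_ord j)
  end.

Definition antipodal : mp -> mp :=
  mmap (mpolyC (2 + 2) (R := K)) antipodal_subst.

Lemma antipodalM : {morph antipodal : P Q / P * Q}.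
Proof. exact: rmorphM. Qed.

Lemma antipodalD : {morph antipodal : P Q / P + Q}.
Proof. exact: rmorphD. Qed.

Lemma antipodal_sum (I : Type) (s : seq I) (Pr : pred I) (F : I -> mp) :
  antipodal (\sum_(i <- s | Pr i) F i) = \sum_(i <- s | Pr i) antipodal (F i).
Proof. exact: raddf_sum. Qed.

Lemma antipodalXn P k : antipodal (P ^+ k) = antipodal P ^+ k.
Proof. exact: rmorphXn. Qed.

Lemma antipodalC c : antipodal (mpolyC (2 + 2) c) = mpolyC (2 + 2) c.
Proof. exact: mmapC. Qed.

Lemma antipodal_nat k : antipodal k%:R = k%:R.
Proof. exact: rmorph_nat. Qed.

Lemma antipodal0 : antipodal 0 = 0.
Proof. exact: raddf0. Qed.

Lemma antipodal_zv j : antipodal (zv K j) = asign j * wv K (rev_ord j).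
Proof.
by rewrite /antipodal /zv mmapX mmap1U /antipodal_subst (unsplitK (inl j)).
Qed.

Lemma antipodal_wv j : antipodal (wv K j) = asign j * zv K (rev_ord j).
Proof.
by rewrite /antipodal /wv mmapX mmap1U /antipodal_subst (unsplitK (inr j)).
Qed.

Lemma asignM j : asign j * asign j = 1.
Proof. by rewrite /asign; case: ifP => _; rewrite ?mulrNN mulr1. Qed.

Lemma asignC j : asign j = mpolyC (2 + 2) (if j == ord0 then -1 else 1).
Proof. by rewrite /asign; case: ifP; rewrite ?mpolyCN mpolyC1. Qed.

Lemma ord2P (P : 'I_2 -> Prop) : P ord0 -> P ord_max -> forall i, P i.
Proof.
move=> P0 P1 i; case: (eqVneq i ord0) => [-> //|i0].
suff -> : i = ord_max by [].
by apply/val_inj; case: i i0 => -[|[]].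
Qed.

Lemma antipodal_zw i j :
  antipodal (zv K i * wv K j) = - (zv K i * wv K j) + (i == j)%:R * r.
Proof.
rewrite antipodalM antipodal_zv antipodal_wv /sqr_radius !big_ord_recl big_ord0.
have e0 : rev_ord (ord0 : 'I_2) = ord_max by apply/val_inj.
have e1 : rev_ord (ord_max : 'I_2) = ord0 by apply/val_inj.
have e2 : lift ord0 ord0 = ord_max :> 'I_2 by apply/val_inj.
by elim/ord2P: i; elim/ord2P: j; rewrite ?e0 ?e1 ?e2 /asign /=; ring.
Qed.

Lemma antipodal_sqr_radius : antipodal r = r.
Proof.
rewrite {1}/sqr_radius antipodal_sum.
rewrite (eq_bigr (fun i => - (zv K i * wv K i) + r)) => [|i _].
  by rewrite big_split /= sumr_const card_ord sumrN -/r; ring.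
by rewrite antipodal_zw eqxx mul1r.
Qed.

Lemma dz_asign j k P : dz j (asign k * P) = asign k * dz j P.
Proof. by rewrite asignC /dz mderiv_mulC. Qed.

Lemma dw_asign j k P : dw j (asign k * P) = asign k * dw j P.
Proof. by rewrite asignC /dw mderiv_mulC. Qed.

Lemma antipodal_delta j k : asign k * ((j == rev_ord k)%:R : mp) =
  asign (rev_ord j) * antipodal (rev_ord j == k)%:R.
Proof.
rewrite antipodal_nat -(inj_eq rev_ord_inj) rev_ordK.
by case: eqP => [->|_]; rewrite ?mulr0.
Qed.

Lemma dz_antipodal j P :
  dz j (antipodal P) = asign (rev_ord j) * antipodal (dw (rev_ord j) P).
Proof.
elim/mpoly_ring_ind: P => [c|i|P Q IP IQ|P Q IP IQ].
- by rewrite antipodalC /dz /dw !mderivC antipodal0 mulr0.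
- rewrite -(splitK i); case: (fintype.split i) => k /=.
    rewrite -/(zv K k) antipodal_zv dz_asign dz_wv dw_zv.
    by rewrite antipodal0 !mulr0.
  by rewrite -/(wv K k) antipodal_wv dz_asign dz_zv dw_wv antipodal_delta.
- by rewrite antipodalD dzD IP IQ dwD antipodalD mulrDr.
- rewrite antipodalM dzM IP IQ dwM antipodalD !antipodalM mulrDr !mulrA.
  by rewrite (mulrC (antipodal P) (asign _)).
Qed.

Lemma dw_antipodal j P :
  dw j (antipodal P) = asign (rev_ord j) * antipodal (dz (rev_ord j) P).
Proof.
elim/mpoly_ring_ind: P => [c|i|P Q IP IQ|P Q IP IQ].
- by rewrite antipodalC /dz /dw !mderivC antipodal0 mulr0.
- rewrite -(splitK i); case: (fintype.split i) => k /=.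
    by rewrite -/(zv K k) antipodal_zv dw_asign dw_wv dz_zv antipodal_delta.
  rewrite -/(wv K k) antipodal_wv dw_asign dw_zv dz_wv.
  by rewrite antipodal0 !mulr0.
- by rewrite antipodalD dwD IP IQ dzD antipodalD mulrDr.
- rewrite antipodalM dwM IP IQ dzM antipodalD !antipodalM mulrDr !mulrA.
  by rewrite (mulrC (antipodal P) (asign _)).
Qed.

Lemma lap_antipodal P : lap (antipodal P) = antipodal (lap P).
Proof.
rewrite /lap antipodal_sum (reindex_inj rev_ord_inj); apply: eq_bigr => j _ /=.
rewrite dw_antipodal dz_asign dz_antipodal rev_ordK mulrA asignM mul1r.
by rewrite /dz /dw mderiv_comm.
Qed.

Lemma bihom_monomial_factor p q (a : multinom (2 + 2)) :
  degz a = p.+1 -> degw a = q.+1 -> exists i j b,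
  [/\ degz b = p, degw b = q & mpolyX K a = zv K i * wv K j * mpolyX K b].
Proof.
move=> ap aq.
have [i ai] : exists i, (0 < a (lshift 2 i))%N.
  case: (pickP (fun k => 0 < a (lshift 2 k))%N) => [k ak|a0]; first by exists k.
  move: ap; rewrite /degz big1 // => k _; apply/eqP.
  by rewrite -leqn0 leqNgt a0.
have [j aj] : exists j, (0 < a (rshift 2 j))%N.
  case: (pickP (fun k => 0 < a (rshift 2 k))%N) => [k ak|a0]; first by exists k.
  move: aq; rewrite /degw big1 // => k _; apply/eqP.
  by rewrite -leqn0 leqNgt a0.
pose c := mnm_add (mnm1 (lshift 2 i)) (mnm1 (rshift 2 j)).
have ec : mnm_add (mnm_sub a c) c = a.
  apply: submK; apply/mnm_lepP => k; rewrite mnmDE !mnm1E.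
  case: (eqVneq (lshift 2 i) k) => [<-|_]; first by rewrite eq_rlshift addn0.
  by rewrite add0n; case: (eqVneq (rshift 2 j) k) => [<-|].
exists i, j, (mnm_sub a c); split.
- by have := ap; rewrite -{1}ec degzD /c degzD degz_lshift degz_rshift; lia.
- by have := aq; rewrite -{1}ec degwD /c degwD degw_lshift degw_rshift; lia.
- by rewrite -{1}ec mpolyXD mulrC /c mpolyXD.
Qed.

(* The products [z_i w_j] change sign under the antipodal map of the Riemann
   sphere, up to multiples of the squared radius. *)
Lemma antipodal_mod_sqr_radius m P : bihom m.+1 m.+1 P ->
  exists2 Q, bihom m m Q & antipodal P = (-1) ^+ m.+1 * P + r * Q.
Proof.
elim/bihom_ind => {P} [|c P1 P2 [Q1 h1 e1] [Q2 h2 e2]|a].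
- exists 0; first exact: bihom0.
  by rewrite !mulr0 addr0 antipodal0.
- exists (c *: Q1 + Q2); first by apply: bihomD => //; apply: bihomZ.
  rewrite -!mul_mpolyC antipodalD antipodalM antipodalC e1 e2; ring.
- elim: m a => [|m IH] a ap aq;
    have [i [j [b [bp bq ->]]]] := bihom_monomial_factor ap aq;
    have := @bihomX K 2 b; rewrite bp bq => hb.
    exists ((i == j)%:R * mpolyX K b).
      exact: (@bihomM _ _ 0 0 0 0 _ _ (@bihom_nat _ _ _) hb).
    suff eb : antipodal (mpolyX K b) = mpolyX K b.
      by rewrite antipodalM antipodal_zw eb; ring.
    by rewrite (deg_eq0 bp bq) mpolyX0 -mpolyC1 antipodalC.
  have [Q hQ eQ] := IH b bp bq.
  exists ((-1) ^+ m.+1 * (i == j)%:R * mpolyX K b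
          + antipodal (zv K i * wv K j) * Q).
    rewrite -signr_odd; apply: bihomD.
      rewrite -[m.+1]add0n; apply: bihomM hb.
      apply: (@bihomM _ _ 0 0 0 0); last exact: bihom_nat.
      by apply: (@bihomXn _ _ 0 0); apply/bihomN/(@bihom_nat _ _ 1).
    rewrite -[m.+1]add1n; apply: bihomM => //; rewrite antipodal_zw.
    apply: bihomD.
      apply: bihomN; apply: (@bihomM _ _ 1 0 0 1); first exact: bihom_zv.
      exact: bihom_wv.
    by apply: (@bihomM _ _ 0 0 1 1); [exact: bihom_nat|exact: bihom_sqr_radius].
  rewrite antipodalM eQ {1}antipodal_zw [in RHS]exprS antipodal_zw; ring.
Qed.

Lemma harmonic_antipodal m P : bihom m m P -> lap P = 0 ->
  antipodal P = (-1) ^+ m * P.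
Proof.
case: m => [|m] hP lapP.
  have -> : P = mpolyC (2 + 2) (mcoeff mnm0 P).
    apply/mpolyP => a; rewrite mcoeffC; case: (eqVneq a mnm0) => [->|a0].
      by rewrite mulr1.
    rewrite mulr0; apply/eqP; rewrite mcoeff_eq0.
    by apply: contra a0 => /hP[az aw]; apply/eqP/deg_eq0.
  by rewrite antipodalC expr0 mul1r.
have [Q hQ eQ] := antipodal_mod_sqr_radius hP.
suff Q0 : Q = 0 by rewrite eQ Q0 mulr0 addr0.
apply: (@harmonic_sqr_radiusM_eq0 K 2 m m) => //.
have -> : r * Q = antipodal P - (-1) ^+ m.+1 * P by rewrite eQ; ring.
rewrite lapB lap_antipodal lapP -signr_odd.
rewrite antipodal0.
by case: odd; rewrite ?expr0 ?expr1 ?mulN1r ?mul1r ?lapN lapP ?oppr0 addr0.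
Qed.

Lemma even_harmonic_decomposition m P :
  bihom m m P -> ~~ odd m -> antipodal P = P ->
  exists h : nat -> mp,
    (forall j, (j <= m)%N -> bihom (m - j) (m - j) (h j) /\ lap (h j) = 0) /\
    P = \sum_(j < m.+1 | ~~ odd j) r ^+ j * h j.
Proof.
move=> hP em tP.
have [h [hh eh]] := @harmonic_decomposition K 2 m m P isT hP; rewrite minnn in hh eh.
exists h; split => //.
have th j : (j <= m)%N -> antipodal (h j) = (-1) ^+ j * h j.
  move=> jm; have [bj lj] := hh j jm; rewrite (harmonic_antipodal bj lj).
  by rewrite -signr_odd oddB // (negbTE em) -[in RHS]signr_odd.
pose s (b : bool) := \sum_(j < m.+1 | odd j == b) r ^+ j * h j.
have eP : P = s true + s false.
  rewrite eh (bigID (fun j : 'I_m.+1 => odd j)) /=; congr (_ + _);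
  by apply: eq_bigl => j; case: odd.
have ets b : antipodal (s b) = (-1) ^+ b * s b.
  rewrite antipodal_sum mulr_sumr; apply: eq_bigr => j /eqP oj.
  rewrite antipodalM antipodalXn antipodal_sqr_radius.
  by rewrite (th j (ltn_ord j)) -signr_odd oj; apply: mulrCA.
suff s0 : s true = 0.
  by rewrite {1}eP s0 add0r; apply: eq_bigl => j; case: odd.
have : 2%:R * s true = 0 :> mp.
  have : antipodal P = P by []; rewrite {1 2}eP antipodalD !ets /=.
  rewrite expr0 expr1 mulN1r mul1r => e.
  have -> : 2%:R * s true = (s true + s false) - (- s true + s false).
    by move: (s true) (s false) => x y; ring.
  by rewrite e subrr.
move/eqP; rewrite mulf_eq0 -mpolyC_nat mpolyC_eq0 pnatr_eq0 /=.
by move/eqP.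
Qed.

End antipodal_symmetry.

(** * Invariant functionals on polynomials *)

Section derivatives_of_monomials.
Variables (K : numFieldType) (N : nat).
Local Notation mp := (mpoly (N + N) K).
Implicit Types (P Q F : mp).
Local Notation zv := (@zv K N).
Local Notation wv := (@wv K N).

Lemma dzXn j P k : dz j (P ^+ k) = k%:R * P ^+ k.-1 * dz j P.
Proof.
elim: k => [|k IH]; first by rewrite expr0 /dz -mpolyC1 mderivC !mul0r.
rewrite exprS dzM IH /= -natr1; case: k {IH} => [|k]; first by rewrite !expr0; ring.
by rewrite exprS; ring.
Qed.

Lemma dwXn j P k : dw j (P ^+ k) = k%:R * P ^+ k.-1 * dw j P.
Proof.
elim: k => [|k IH]; first by rewrite expr0 /dw -mpolyC1 mderivC !mul0r.
rewrite exprS dwM IH /= -natr1; case: k {IH} => [|k]; first by rewrite !expr0; ring.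
by rewrite exprS; ring.
Qed.

Lemma dz_lap j P : dz j (lap P) = lap (dz j P).
Proof.
rewrite /lap /dz (raddf_sum (mderiv (lshift N j))); apply: eq_bigr => k _ /=.
by rewrite mderiv_comm; congr mderiv; rewrite /dw mderiv_comm.
Qed.

Lemma dw_lap j P : dw j (lap P) = lap (dw j P).
Proof.
rewrite /lap /dw (raddf_sum (mderiv (rshift N j))); apply: eq_bigr => k _ /=.
by rewrite /dz mderiv_comm; congr mderiv; rewrite mderiv_comm.
Qed.

Lemma bihom_zwXn i j p q : bihom p q (zv i ^+ p * wv j ^+ q).
Proof.
rewrite -[X in bihom X]addn0 -[X in bihom _ X]add0n; apply: bihomM.
  by rewrite -[X in bihom X]mul1n -(mul0n p); apply/bihomXn/bihom_zv.
by rewrite -[X in bihom _ X]mul1n -(mul0n q); apply/bihomXn/bihom_wv.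
Qed.

Lemma lap_zwM p q P Q : bihom p 0 P -> bihom 0 q Q ->
  lap (P * Q) = \sum_j dz j P * dw j Q.
Proof.
move=> hP hQ; rewrite lapM (lap_bihom0w hP) (lap_bihom0z hQ) mul0r mulr0 !add0r.
by apply: eq_bigr => j _; rewrite (bihom0_dw _ hP) mul0r addr0.
Qed.

Lemma lap_zwXn i j p q : i != j -> lap (zv i ^+ p * wv j ^+ q) = 0.
Proof.
move=> ij; rewrite (@lap_zwM (1 * p) (1 * q)).
- rewrite big1 // => t _; rewrite dzXn dwXn dz_zv dw_wv.
  case: (eqVneq t i) => [->|_]; last by rewrite !mulr0 mul0r.
  by rewrite (negbTE ij) !mulr0.
- by rewrite -[X in bihom _ X](mul0n p); apply/bihomXn/bihom_zv.
- by rewrite -[X in bihom X](mul0n q); apply/bihomXn/bihom_wv.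
Qed.

Lemma bihom_zww i j k a : bihom a.+1 a.+1 (zv k ^+ a.+1 * (wv i ^+ a * wv j)).
Proof.
rewrite mulrA -[X in bihom X]addn0 -[X in bihom _ X]addn1.
by apply: bihomM; [exact: bihom_zwXn|exact: bihom_wv].
Qed.

Lemma lap_zww i j k a : i != k -> j != k ->
  lap (zv k ^+ a.+1 * (wv i ^+ a * wv j)) = 0.
Proof.
move=> ik jk; rewrite (@lap_zwM (1 * a.+1) (1 * a + 1)).
- rewrite big1 // => t _; rewrite dzXn dz_zv dwM dwXn !dw_wv.
  case: (eqVneq t k) => [->|_]; last by rewrite mulr0 mul0r.
  rewrite [k == i]eq_sym [k == j]eq_sym (negbTE ik) (negbTE jk).
  by rewrite !mulr0 mul0r addr0 mulr0.
- by rewrite -[X in bihom _ X](mul0n a.+1); apply/bihomXn/bihom_zv.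
- apply: (@bihomM _ _ 0 _ 0 1).
    by rewrite -[X in bihom X](mul0n a); apply/bihomXn/bihom_wv.
  exact: bihom_wv.
Qed.

(* Up to a constant, [z_j d/dz_i - w_i d/dw_j] applied to the highest weight vector
   [z_i^(b+1) w_j^(b+1)]. *)
Definition twisted i j b : mp :=
  zv i ^+ b * wv j ^+ b * (zv i * wv i - zv j * wv j).

Lemma bihom_twisted i j b : bihom b.+1 b.+1 (twisted i j b).
Proof.
rewrite -addn1; apply: bihomM; first exact: bihom_zwXn.
by apply: bihomB; apply: (@bihom_zwXn _ _ 1 1).
Qed.

Lemma lap_twisted i j b : i != j -> lap (twisted i j b) = 0.
Proof.
move=> ij; have -> : twisted i j b =
    zv i ^+ b.+1 * (wv i * wv j ^+ b) - zv i ^+ b * zv j * (wv j ^+ b.+1).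
  by rewrite /twisted !exprS; ring.
have hz k l : bihom l 0 (zv k ^+ l).
  by rewrite -[X in bihom X]mul1n -(mul0n l); apply/bihomXn/bihom_zv.
have hw k l : bihom 0 l (wv k ^+ l).
  by rewrite -[X in bihom _ X]mul1n -(mul0n l); apply/bihomXn/bihom_wv.
rewrite lapB.
rewrite (lap_zwM (hz i b.+1) (bihomM (@bihom_wv K N i) (hw j b))).
rewrite (lap_zwM (bihomM (hz i b) (@bihom_zv K N j)) (hw j b.+1)).
rewrite (bigD1 i) //= big1 ?addr0 => [|t ti]; last first.
  by rewrite dzXn dz_zv (negbTE ti) mulr0 mul0r.
rewrite (bigD1 j) //= big1 ?addr0 => [|t tj]; last first.
  by rewrite dwXn dw_wv (negbTE tj) !mulr0.
rewrite dzXn dwM dwXn dzM dzXn dwXn !dz_zv !dw_wv !eqxx (negbTE ij).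
by rewrite eq_sym (negbTE ij) /=; ring.
Qed.

End derivatives_of_monomials.

Section invariant_functional.
Variables (K : numFieldType) (N : nat).
Local Notation mp := (mpoly (N + N) K).
Implicit Types (P Q F : mp).
Local Notation zv := (@zv K N).
Local Notation wv := (@wv K N).
Local Notation r := (sqr_radius K N).
Variable L : mp -> K.
Hypothesis LD : forall P Q, L (P + Q) = L P + L Q.
Hypothesis LZ : forall c P, L (c *: P) = c * L P.
Hypothesis L1 : L 1 = 1.
Hypothesis L_sphere : forall P, L (r * P) = L P.
Hypothesis L_inv : forall j k P, L (zv j * dz k P) = L (wv k * dw j P).

Lemma functional0 : L 0 = 0.
Proof. by rewrite -(scale0r 0) LZ mul0r. Qed.

Lemma functionalN P : L (- P) = - L P.
Proof. by rewrite -scaleN1r LZ mulN1r. Qed.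

Lemma functional_nat n P : L (n%:R * P) = n%:R * L P.
Proof. by rewrite mulr_natl -scaler_nat LZ. Qed.

Lemma functional_sum (I : Type) (s : seq I) (Pr : pred I) (F : I -> mp) :
  L (\sum_(i <- s | Pr i) F i) = \sum_(i <- s | Pr i) L (F i).
Proof. exact: (big_morph L LD functional0). Qed.

Lemma functional_rank_one (h : K) (v w : 'I_N -> K) P : h != 0 ->
  L (mderiv_along
       (fun j => mpolyC _ (h * v j) * (\sum_k mpolyC _ (w k) * zv k))
       (fun j => mpolyC _ (- h * w j) * (\sum_k mpolyC _ (v k) * wv k)) P) = 0 ->
  \sum_j \sum_k v j * w k * (L (zv k * dz j P) - L (wv j * dw k P)) = 0.
Proof.
move=> h0 eG; apply: (mulfI h0); rewrite mulr0 -[RHS]eG /mderiv_along.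
pose A j := \sum_k v j * w k * L (zv k * dz j P).
pose B j := \sum_k v k * w j * L (wv k * dw j P).
have e1 j : L (mpolyC _ (h * v j) * (\sum_k mpolyC _ (w k) * zv k) * dz j P) = h * A j.
  rewrite -mulrA mul_mpolyC LZ -mulrA /A mulr_suml functional_sum !mulr_sumr.
  by apply: eq_bigr => k _; rewrite -mulrA mul_mpolyC LZ; ring.
have e2 j :
    L (mpolyC _ (- h * w j) * (\sum_k mpolyC _ (v k) * wv k) * dw j P) = - h * B j.
  rewrite -mulrA mul_mpolyC LZ -mulrA /B mulr_suml functional_sum !mulr_sumr.
  by apply: eq_bigr => k _; rewrite -mulrA mul_mpolyC LZ; ring.
have -> : \sum_j \sum_k v j * w k * (L (zv k * dz j P) - L (wv j * dw k P)) =
    \sum_j A j - \sum_j B j.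
  have -> : \sum_j B j = \sum_j \sum_k v j * w k * L (wv j * dw k P).
    exact: exchange_big.
  rewrite -sumrB; apply: eq_bigr => j _; rewrite -sumrB; apply: eq_bigr => k _.
  by rewrite mulrBr.
rewrite functional_sum mulrBr mulr_sumr [X in _ - X]mulr_sumr -sumrB.
by apply: eq_bigr => j _; rewrite LD e1 e2 mulNr.
Qed.

Lemma functional_bidegree p q P : bihom p q P -> p != q -> L P = 0.
Proof.
move=> hP pq; have : p%:R * L P = q%:R * L P.
  rewrite -!functional_nat -(euler_z hP) -(euler_w hP) !functional_sum.
  by apply: eq_bigr => j _; apply: L_inv.
move/eqP; rewrite -subr_eq0 -mulrBl mulf_eq0 subr_eq0 eqr_nat (negbTE pq).
by move/eqP.
Qed.

(* A mean value property, iterating the invariance once in each of the two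
   derivatives of the Laplacian. *)
Lemma functional_lap p q P : bihom p q P ->
  L (lap P) = (q * (N + q.-1))%:R * L P.
Proof.
move=> hP; rewrite -L_sphere /sqr_radius mulr_suml functional_sum.
have e j : L (zv j * wv j * lap P) =
    \sum_k L (wv k * (dw k P + wv j * dw j (dw k P))).
  rewrite /lap mulr_sumr functional_sum; apply: eq_bigr => k _.
  transitivity (L (zv j * dz k (wv j * dw k P))).
    by rewrite dzM dz_wv mul0r add0r mulrA.
  by rewrite L_inv dwM dw_wv eqxx mul1r.
rewrite (eq_bigr _ (fun j _ => e j)) exchange_big /=.
transitivity (\sum_k L ((N + q.-1)%:R * (wv k * dw k P))).
  apply: eq_bigr => k _; rewrite -functional_sum -mulr_sumr big_split /=.
  rewrite (euler_w (bihom_dw (j := k) hP)) sumr_const card_ord natrD.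
  by congr L; ring.
rewrite -functional_sum -mulr_sumr (euler_w hP) mulrA -natrM functional_nat.
by rewrite mulnC.
Qed.

Lemma functional_eq0 p q P : (0 < N)%N -> bihom p q P -> (0 < q)%N ->
  L (lap P) = 0 -> L P = 0.
Proof.
move=> N0 hP q0; rewrite (functional_lap hP) => /eqP; rewrite mulf_eq0.
by rewrite pnatr_eq0 => /orP[|/eqP//]; lia.
Qed.

Lemma functional_orthogonal i j p q k l F : i != j ->
  bihom p q F -> lap F = 0 -> (p, q) <> (k, l) ->
  L (F * (zv j ^+ l * wv i ^+ k)) = 0.
Proof.
move=> ij; have N0 : (0 < N)%N by case: (N) i {ij} => [[]|].
have [s] := ubnP (k + l); elim: s => // s IH in p q k l F *.
move=> ks hF lF pqkl.
have hFh : bihom (p + l) (q + k) (F * (zv j ^+ l * wv i ^+ k)).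
  by apply: bihomM => //; apply: bihom_zwXn.
case: (eqVneq (p + l)%N (q + k)%N) => [e|]; last exact: functional_bidegree.
have qk : (0 < q + k)%N.
  rewrite lt0n; apply: contra_notN pqkl => /eqP qk0.
  by congr pair; lia.
apply: (functional_eq0 N0 hFh qk).
rewrite lapM lF lap_zwXn 1?eq_sym // mul0r mulr0 !add0r functional_sum.
rewrite big1 // => t _.
have -> : dz t F * dw t (zv j ^+ l * wv i ^+ k)
    + dw t F * dz t (zv j ^+ l * wv i ^+ k)
  = (k%:R * (t == i)%:R) * (dz t F * (zv j ^+ l * wv i ^+ k.-1))
    + (l%:R * (t == j)%:R) * (dw t F * (zv j ^+ l.-1 * wv i ^+ k)).
  rewrite dzM dwM !dzXn !dwXn dz_wv dz_zv dw_zv dw_wv; ring.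
rewrite -!natrM LD !functional_nat.
suff [-> ->] : (k * (t == i))%:R * L (dz t F * (zv j ^+ l * wv i ^+ k.-1)) = 0
   /\ (l * (t == j))%:R * L (dw t F * (zv j ^+ l.-1 * wv i ^+ k)) = 0.
  by rewrite addr0.
split.
- case: (posnP k) => [->|k0]; first by rewrite mul0r.
  case: (posnP p) hF pqkl {e hFh} => [->|p0] hF pqkl.
    by rewrite (bihom0_dz _ hF) mul0r functional0 mulr0.
  rewrite (IH p.-1 q) ?mulr0 //; first by lia.
  - exact: bihom_dz.
  - by rewrite -dz_lap lF /dz mderiv0.
  - by move=> [e1 e2]; apply: pqkl; congr pair; lia.
- case: (posnP l) => [->|l0]; first by rewrite mul0r.
  case: (posnP q) hF pqkl {e hFh qk} => [->|q0] hF pqkl.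
    by rewrite (bihom0_dw _ hF) mul0r functional0 mulr0.
  rewrite (IH p q.-1) ?mulr0 //; first by lia.
  - exact: bihom_dw.
  - by rewrite -dw_lap lF /dw mderiv0.
  - by move=> [e1 e2]; apply: pqkl; congr pair; lia.
Qed.

Lemma functional_monomial_gt0 (a : multinom (N + N)) :
  (forall j, a (lshift N j) = a (rshift N j)) -> 0 < L (mpolyX K a).
Proof.
have [s] := ubnP (degw a); elim: s => // s IH in a *; move=> ws ha.
have ezw : degz a = degw a by apply: eq_bigr => j _.
case: (posnP (degw a)) => [w0|w0].
  by rewrite (deg_eq0 _ w0) ?ezw // mpolyX0 L1.
pose b j := mnm_sub (mnm_sub a (mnm1 (rshift N j))) (mnm1 (lshift N j)).
have eL : (degw a * (N + (degw a).-1))%:R * L (mpolyX K a) =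
    \sum_j (a (lshift N j) ^ 2)%:R * L (mpolyX K (b j)).
  rewrite -(functional_lap (@bihomX K N a)) /lap functional_sum.
  apply: eq_bigr => j _; rewrite /dw /dz mderivX mderivZ mderivX scalerA LZ.
  by rewrite mnmBE mnm1E eq_rlshift subn0 -ha -natrM mulnn.
have b0 j : (0 < a (lshift N j))%N -> 0 < L (mpolyX K (b j)).
  move=> aj; apply: IH => [|k].
    rewrite ltnS in ws; apply: leq_trans _ ws.
    have <- : mnm_add (mnm_add (b j) (mnm1 (lshift N j))) (mnm1 (rshift N j)) = a.
      rewrite !submK //; apply/mnm_lepP => k; rewrite ?mnmBE !mnm1E;
        case: eqP => // <-; first by rewrite -ha.
      by rewrite eq_rlshift subn0.
    by rewrite !degwD degw_lshift degw_rshift addn0 addn1.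
  rewrite !mnmBE !mnm1E eq_rlshift eq_lrshift (inj_eq (@lshift_inj _ _)).
  rewrite (inj_eq (@rshift_inj _ _)) !subn0. by rewrite ha.
have [i ai] : exists i, (0 < a (lshift N i))%N.
  case: (pickP (fun k => 0 < a (lshift N k))%N) => [k ak|a0]; first by exists k.
  move: w0; rewrite -ezw /degz big1 // => k _; apply/eqP.
  by rewrite -leqn0 leqNgt a0.
have N0 : (0 < N)%N by case: (N) i {ai} => [[]|].
have : 0 < (degw a * (N + (degw a).-1))%:R * L (mpolyX K a).
  rewrite eL (bigD1 i) //= ltr_pwDl ?mulr_gt0 ?b0 ?ltr0n ?expn_gt0 ?ai //.
  apply: sumr_ge0 => j _; case: (posnP (a (lshift N j))) => [->|aj].
    by rewrite exp0n // mul0r.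
  by rewrite mulr_ge0 ?ler0n // ltW // b0.
by rewrite pmulr_rgt0 // ltr0n muln_gt0 w0 addn_gt0 N0.
Qed.

Definition diagonal P := exists2 a : multinom (N + N),
  P = mpolyX K a & forall j, a (lshift N j) = a (rshift N j).

Lemma diagonalM P Q : diagonal P -> diagonal Q -> diagonal (P * Q).
Proof.
move=> [a -> ha] [b -> hb]; exists (mnm_add a b); first by rewrite mpolyXD.
by move=> j; rewrite !mnmDE ha hb.
Qed.

Lemma diagonal_zw i : diagonal (zv i * wv i).
Proof.
exists (mnm_add (mnm1 (lshift N i)) (mnm1 (rshift N i))); first by rewrite mpolyXD.
move=> j; rewrite !mnmDE !mnm1E eq_rlshift eq_lrshift addn0 add0n.
by rewrite (inj_eq (@lshift_inj _ _)) (inj_eq (@rshift_inj _ _)).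
Qed.

Lemma diagonalXn P k : diagonal P -> diagonal (P ^+ k).
Proof.
move=> dP; elim: k => [|k IH]; last by rewrite exprS; apply: diagonalM.
by rewrite expr0; exists mnm0; [rewrite mpolyX0|move=> j; rewrite !mnm0E].
Qed.

Lemma functional_diagonal_gt0 P : diagonal P -> 0 < L P.
Proof. by move=> [a -> ha]; apply: functional_monomial_gt0. Qed.

Section two_variable_moments.
Variables (i j : 'I_N).
Hypothesis ij : i != j.

Definition moment A B := L ((zv i * wv i) ^+ A * (zv j * wv j) ^+ B).

Lemma moment_gt0 A B : 0 < moment A B.
Proof.
apply: functional_diagonal_gt0.
by apply: diagonalM; apply/diagonalXn/diagonal_zw.
Qed.

Lemma moment_shift A B :
  B.+1%:R * moment A.+1 B = A.+1%:R * moment A B.+1.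
Proof.
pose P := zv i ^+ A.+1 * wv i ^+ A * zv j ^+ B * wv j ^+ B.+1.
have ji : (j == i) = false by rewrite eq_sym (negbTE ij).
have dzP : dz i P = A.+1%:R * zv i ^+ A * wv i ^+ A * zv j ^+ B * wv j ^+ B.+1.
  rewrite /P !dzM !dzXn !dz_zv !dz_wv eqxx (negbTE ij) /=.
  by move: (zv i) (wv i) (zv j) (wv j) => zi wi zj wj; ring.
have dwP : dw j P = zv i ^+ A.+1 * wv i ^+ A * zv j ^+ B * (B.+1%:R * wv j ^+ B).
  rewrite /P !dwM !dwXn !dw_zv !dw_wv eqxx ji /=.
  by move: (zv i) (wv i) (zv j) (wv j) => zi wi zj wj; ring.
have := L_inv j i P; rewrite dzP dwP /moment -!functional_nat => e.
transitivity (L (wv i * (zv i ^+ A.+1 * wv i ^+ A * zv j ^+ B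
    * (B.+1%:R * wv j ^+ B)))).
  congr L; move: (zv i) (wv i) (zv j) (wv j) => zi wi zj wj.
  by rewrite !exprMn !exprS; ring.
apply: (etrans (esym e)).
apply: (congr1 L).
move: (zv i) (wv i) (zv j) (wv j) => zi wi zj wj.
by rewrite !exprMn !exprS; ring.
Qed.

Lemma moment_sub_neq0 A B : A != B -> moment A.+1 B - moment A B.+1 != 0.
Proof.
move=> AB; apply: contra AB; rewrite subr_eq0 => /eqP e.
have := moment_shift A B; rewrite e => /(mulIf (lt0r_neq0 (moment_gt0 _ _))).
by move/eqP; rewrite eqr_nat eqSS eq_sym.
Qed.

Lemma moment_sqr_neq0 A :
  moment A.+2 A + moment A A.+2 - 2%:R * moment A.+1 A.+1 != 0.
Proof.
have e1 := moment_shift A.+1 A; have e2 := moment_shift A A.+1.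
have M0 := moment_gt0 A.+1 A.+1.
have A1 : A.+1%:R != 0 :> K by rewrite pnatr_eq0.
apply: lt0r_neq0; rewrite -(pmulr_rgt0 _ (ltr0Sn K A)).
have -> : A.+1%:R * (moment A.+2 A + moment A A.+2 - 2%:R * moment A.+1 A.+1)
   = 2%:R * moment A.+1 A.+1.
  rewrite mulrBr mulrDr e1 -e2 -(natr1 A.+1); ring.
by rewrite mulr_gt0.
Qed.

End two_variable_moments.

Lemma functional_top_neq0 i j p q p' q' :
  L (zv i ^+ p * wv j ^+ q * (zv i ^+ p' * wv j ^+ q')
     * (zv j ^+ (q + q') * wv i ^+ (p + p'))) != 0.
Proof.
apply: lt0r_neq0; rewrite (_ : _ * _ = (zv i * wv i) ^+ (p + p')
  * (zv j * wv j) ^+ (q + q')); first exact: moment_gt0.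
move: (zv i) (wv i) (zv j) (wv j) => zi wi zj wj.
by rewrite !exprMn !exprD; ring.
Qed.

Lemma functional_lower_neq0 i j p q b :
  L (zv i ^+ (p + b) * wv j ^+ (q + b) * (zv j ^+ b * wv i ^+ b)
     * (zv j ^+ q * wv i ^+ p)) != 0.
Proof.
apply: lt0r_neq0; rewrite (_ : _ * _ = (zv i * wv i) ^+ (p + b)
  * (zv j * wv j) ^+ (q + b)); first exact: moment_gt0.
move: (zv i) (wv i) (zv j) (wv j) => zi wi zj wj.
by rewrite !exprMn !exprD; ring.
Qed.

Lemma functional_three_neq0 i j k a :
  L (zv i ^+ a.+1 * wv k ^+ a.+1 * (zv k ^+ a.+1 * (wv i ^+ a * wv j))
     * (zv j ^+ 1 * wv i ^+ 1)) != 0.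
Proof.
apply: lt0r_neq0; rewrite (_ : _ * _ =
  (zv i * wv i) ^+ a.+1 * (zv k * wv k) ^+ a.+1 * (zv j * wv j)); last first.
  move: (zv i) (wv i) (zv j) (wv j) (zv k) (wv k) => zi wi zj wj zk wk.
  by rewrite !exprMn !exprS; ring.
apply: functional_diagonal_gt0.
by apply: diagonalM; [apply: diagonalM; apply: diagonalXn|]; apply: diagonal_zw.
Qed.

Lemma functional_twisted_sqr_neq0 i j b : i != j ->
  L (twisted K i j b * twisted K i j b * (zv j ^+ (b + b) * wv i ^+ (b + b))) != 0.
Proof.
move=> ij; have := moment_sqr_neq0 ij (b + b); congr (_ != 0).
rewrite /moment -functional_nat -functionalN -!LD; congr L.
rewrite /twisted; move: (zv i) (wv i) (zv j) (wv j) => zi wi zj wj.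
by rewrite !exprMn !exprS !exprD; ring.
Qed.

Lemma functional_twisted_up_neq0 i j p q : i != j -> p != q ->
  L (zv i ^+ p * wv j ^+ q * twisted K i j 1
     * (zv j ^+ q.+1 * wv i ^+ p.+1)) != 0.
Proof.
move=> ij pq; have := @moment_sub_neq0 _ _ ij p.+1 q.+1 pq; congr (_ != 0).
rewrite /moment -functionalN -!LD; congr L.
rewrite /twisted; move: (zv i) (wv i) (zv j) (wv j) => zi wi zj wj.
by rewrite !exprMn !exprS; ring.
Qed.

Lemma functional_twisted_down_neq0 i j p q : i != j -> p != q ->
  L (zv i ^+ p.+1 * wv j ^+ q.+1 * twisted K j i 1
     * (zv j ^+ q * wv i ^+ p)) != 0.
Proof.
move=> ij pq; have := @moment_sub_neq0 _ _ ij p.+1 q.+1 pq.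
rewrite -oppr_eq0; congr (_ != 0).
rewrite /moment -!functionalN -!LD -functionalN; congr L.
rewrite /twisted; move: (zv i) (wv i) (zv j) (wv j) => zi wi zj wj.
by rewrite !exprMn !exprS; ring.
Qed.

End invariant_functional.

(** * Harmonic functions *)

Local Open Scope classical_set_scope.
Local Open Scope ring_scope.
Local Open Scope complex_scope.

Section evaluation.
Variables (R : realType) (m : nat).
Local Notation Cn := 'rV[(R[i])^o]_m.+1.
Local Notation mp := (mpoly (m.+1 + m.+1) (R[i] : numFieldType)).
Local Notation zv := (@zv R[i] m.+1).
Local Notation wv := (@wv R[i] m.+1).
Implicit Types (P Q : mp) (z v : Cn).

Lemma conjcD (x y : R[i]) : conjc (x + y) = conjc x + conjc y.
Proof. exact: (rmorphD (@conjc R)). Qed.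

Lemma conjcM (x y : R[i]) : conjc (x * y) = conjc x * conjc y.
Proof. exact: (rmorphM (@conjc R)). Qed.

Lemma evalD P Q z : eval_zzbar (P + Q) z = eval_zzbar P z + eval_zzbar Q z.
Proof. exact: mevalD. Qed.

Lemma evalM P Q z : eval_zzbar (P * Q) z = eval_zzbar P z * eval_zzbar Q z.
Proof. exact: mevalM. Qed.

Lemma evalZ c P z : eval_zzbar (c *: P) z = c * eval_zzbar P z.
Proof. exact: mevalZ. Qed.

Lemma evalC c z : eval_zzbar (mpolyC (m.+1 + m.+1) c) z = c.
Proof. exact: mevalC. Qed.

Lemma eval0 z : eval_zzbar (0 : mp) z = 0.
Proof. exact: meval0. Qed.

Lemma eval_sum (I : Type) (s : seq I) (Pr : pred I) (F : I -> mp) z :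
  eval_zzbar (\sum_(i <- s | Pr i) F i) z =
  \sum_(i <- s | Pr i) eval_zzbar (F i) z.
Proof. exact: raddf_sum. Qed.

Lemma evalXn P k z : eval_zzbar (P ^+ k) z = eval_zzbar P z ^+ k.
Proof. exact: rmorphXn. Qed.

Lemma eval_zv j z : eval_zzbar (zv j) z = z ord0 j.
Proof. by rewrite /eval_zzbar mevalXU (unsplitK (inl j)). Qed.

Lemma eval_wv j z : eval_zzbar (wv j) z = conjc (z ord0 j : R[i]).
Proof. by rewrite /eval_zzbar mevalXU (unsplitK (inr j)). Qed.

Lemma eval_sqr_radius z : eval_zzbar (sqr_radius R[i] m.+1) z = sqnorm z.
Proof.
rewrite eval_sum; apply: eq_bigr => j _; rewrite evalM eval_zv eval_wv.
by rewrite sqr_normc.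
Qed.

Definition line_subst z v (k : 'I_(m.+1 + m.+1)) : {poly R[i]} :=
  match fintype.split k with
  | inl j => (z ord0 j : R[i])%:P + (v ord0 j : R[i])%:P * 'X
  | inr j => (conjc (z ord0 j : R[i]))%:P + (conjc (v ord0 j : R[i]))%:P * 'X
  end.

Definition line z v : mp -> {poly R[i]} := mmap (@polyC R[i]) (line_subst z v).

Lemma lineD z v P Q : line z v (P + Q) = line z v P + line z v Q.
Proof. exact: mmapD. Qed.

Lemma lineM z v P Q : line z v (P * Q) = line z v P * line z v Q.
Proof. exact: rmorphM. Qed.

Lemma lineC z v c : line z v (mpolyC (m.+1 + m.+1) c) = c%:P.
Proof. exact: mmapC. Qed.

Lemma line_zv z v j :
  line z v (zv j) = (z ord0 j : R[i])%:P + (v ord0 j : R[i])%:P * 'X.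
Proof. by rewrite /line mmapX mmap1U /line_subst (unsplitK (inl j)). Qed.

Lemma line_wv z v j :
  line z v (wv j) = (conjc (z ord0 j : R[i]))%:P + (conjc (v ord0 j : R[i]))%:P * 'X.
Proof. by rewrite /line mmapX mmap1U /line_subst (unsplitK (inr j)). Qed.

Lemma mpoly_zw_ind (Pr : mp -> Prop) :
  (forall c, Pr (mpolyC _ c)) -> (forall j, Pr (zv j)) -> (forall j, Pr (wv j)) ->
  (forall P Q, Pr P -> Pr Q -> Pr (P + Q)) ->
  (forall P Q, Pr P -> Pr Q -> Pr (P * Q)) ->
  forall P, Pr P.
Proof.
move=> PC Pz Pw PD PM; apply: mpoly_ring_ind => // i.
by rewrite -(splitK i); case: (fintype.split i).
Qed.

Lemma line_entry z v (c : R[i]) j :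
  (z + c *: v) ord0 j = (z ord0 j : R[i]) + c * (v ord0 j : R[i]) :> R[i].
Proof. by rewrite !mxE. Qed.

Lemma line_horner z v P (t : R) :
  (line z v P).[t%:C] = eval_zzbar P (z + t%:C *: v).
Proof.
elim/mpoly_zw_ind: P => [c|j|j|P Q IP IQ|P Q IP IQ].
- by rewrite lineC hornerC evalC.
- by rewrite line_zv !hornerE eval_zv line_entry mulrC.
- by rewrite line_wv !hornerE eval_wv line_entry conjcD conjcM conjc_real mulrC.
- by rewrite lineD hornerD evalD IP IQ.
- by rewrite lineM hornerM evalM IP IQ.
Qed.

Definition dirderiv v P : mp := mderiv_along
  (fun j => mpolyC _ (v ord0 j : R[i]))
  (fun j => mpolyC _ (conjc (v ord0 j : R[i]))) P.

Lemma deriv_line z v P : (line z v P)^`() = line z v (dirderiv v P).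
Proof.
elim/mpoly_zw_ind: P => [c|j|j|P Q IP IQ|P Q IP IQ].
- by rewrite lineC derivC /dirderiv mderiv_alongC -mpolyC0 lineC.
- rewrite line_zv /dirderiv mderiv_along_zv lineC derivD !derivC derivM derivC.
  by rewrite derivX add0r mul0r add0r mulr1.
- rewrite line_wv /dirderiv mderiv_along_wv lineC derivD !derivC derivM derivC.
  by rewrite derivX add0r mul0r add0r mulr1.
- by rewrite lineD derivD IP IQ /dirderiv mderiv_alongD lineD.
- by rewrite lineM derivM IP IQ /dirderiv mderiv_alongM lineD !lineM.
Qed.

Lemma eval_eq0_poly (p : {poly R[i]}) : (forall t : R, p.[t%:C] = 0) -> p = 0.
Proof.
move=> p0; apply/eqP; apply: contraT => pN0.
have := max_poly_roots (rs := [seq (k%:R)%:C | k <- iota 0 (size p)]) pN0.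
rewrite size_map size_iota ltnn; apply.
  by apply/allP => _ /mapP[k _ ->]; rewrite rootE p0.
rewrite map_inj_uniq ?iota_uniq // => k l /complexI /eqP.
by rewrite eqr_nat => /eqP.
Qed.

Lemma eval_dirderiv_eq0 P v : (forall z, eval_zzbar P z = 0) ->
  forall z, eval_zzbar (dirderiv v P) z = 0.
Proof.
move=> P0 z; have -> : z = z + (0 : R)%:C *: v by rewrite scale0r addr0.
rewrite -line_horner -deriv_line.
have -> : line z v P = 0; last by rewrite deriv0 horner0.
by apply: eval_eq0_poly => t; rewrite line_horner P0.
Qed.

Let e_ j : Cn := delta_mx ord0 j.
Let ie_ j : Cn := (0 +i* 1) *: delta_mx ord0 j.

Lemma dirderiv_e j P : dirderiv (e_ j) P = dz j P + dw j P.
Proof.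
rewrite -[dz j P]scale1r -[dw j P]scale1r; apply: mderiv_along_delta => k; congr mpolyC.
  by rewrite mxE eqxx /=; case: eqP.
by rewrite mxE eqxx /=; case: eqP; rewrite ?conjc1 ?conjc0.
Qed.

Lemma dirderiv_ie j P : dirderiv (ie_ j) P =
  (0 +i* 1 : R[i]) *: dz j P + (- (0 +i* 1) : R[i]) *: dw j P.
Proof.
apply: mderiv_along_delta => k; congr mpolyC; rewrite !mxE eqxx /=; case: eqP => _.
- by rewrite mulr1.
- by rewrite mulr0.
- by rewrite mulr1; apply/eqP; rewrite eq_complex /= oppr0 !eqxx.
- by rewrite mulr0 conjc0.
Qed.

Lemma eval_derivs_eq0 P : (forall z, eval_zzbar P z = 0) ->
  forall k z, eval_zzbar (mderiv k P) z = 0.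
Proof.
move=> P0; have dP j z : eval_zzbar (dz j P) z = 0 /\ eval_zzbar (dw j P) z = 0.
  have := eval_dirderiv_eq0 (e_ j) P0 z.
  have := eval_dirderiv_eq0 (ie_ j) P0 z.
  rewrite dirderiv_e dirderiv_ie 2!evalD (evalZ _ (dz j P)) (evalZ _ (dw j P)).
  rewrite mulNr -mulrBr => /eqP.
  rewrite mulf_eq0 eq_complex /= oner_eq0 andbF /= subr_eq0 => /eqP ->.
  by move=> /eqP; rewrite -mulr2n mulrn_eq0 => /eqP ->.
move=> k z; rewrite -(splitK k); case: (fintype.split k) => j /=.
  exact: (dP j z).1.
exact: (dP j z).2.
Qed.

Lemma eval_at0 P : eval_zzbar P 0 = mcoeff mnm0 P.
Proof.
elim/mpoly_zw_ind: P => [c|j|j|P Q IP IQ|P Q IP IQ].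
- by rewrite evalC mcoeffC eqxx mulr1.
- by rewrite eval_zv mxE mcoeffX -mdeg_eq0 mdeg1.
- by rewrite eval_wv mxE conjc0 mcoeffX -mdeg_eq0 mdeg1.
- by rewrite evalD IP IQ mcoeffD.
- by rewrite evalM IP IQ (rmorphM (mcoeff mnm0)).
Qed.

Lemma eval_inj P : (forall z, eval_zzbar P z = 0) -> P = 0.
Proof.
move=> P0; apply/mpolyP => a; rewrite mcoeff0.
have [s] := ubnP (mdeg a); elim: s => // s IH in a P P0 *; rewrite ltnS => sa.
case: (pickP (fun k => 0 < a k)%N) => [k ak|a0]; last first.
  have -> : a = mnm0.
    by apply/mnmP => k; rewrite mnm0E; apply/eqP; rewrite -leqn0 leqNgt a0.
  by rewrite -eval_at0.
have ea : mnm_add (mnm_sub a (mnm1 k)) (mnm1 k) = a.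
  by apply: submK; apply/mnm_lepP => l; rewrite mnm1E; case: eqP => // <-.
have /eqP : mcoeff (mnm_sub a (mnm1 k)) (mderiv k P) = 0.
  apply: IH; first exact: eval_derivs_eq0.
  by apply: leq_trans sa; rewrite -{2}ea mdegD mdeg1 addn1.
by rewrite mcoeff_mderiv ea mulrn_eq0 => /eqP.
Qed.

Definition poly_part (f : R[i] -> R) (p : {poly R[i]}) : {poly R} :=
  \poly_(k < size p) f p`_k.

Lemma horner_poly_part (f : R[i] -> R) :
  (forall x y, f (x + y) = f x + f y) -> (forall (t : R) x, f (t%:C * x) = t * f x) ->
  forall p (t : R), f p.[t%:C] = (poly_part f p).[t].
Proof.
move=> fD fZ p t; have f0 : f 0 = 0 by rewrite -(mul0r 0) (fZ 0) mul0r.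
rewrite horner_coef horner_poly (big_morph f fD f0); apply: eq_bigr => k _.
by rewrite -rmorphXn mulrC fZ mulrC.
Qed.

Lemma poly_part_deriv2 (f : R[i] -> R) p :
  f 0 = 0 -> (forall x n, f (x *+ n) = f x *+ n) ->
  (poly_part f p)^`()^`().[0] = f p^`()^`().[0].
Proof.
move=> f0 fMn; rewrite !horner_coef0 !coef_deriv coef_poly !fMn.
by case: ltnP => // sp; rewrite nth_default ?f0.
Qed.

Lemma second_derivative_eval (f : R[i] -> R) P v z :
  (forall x y, f (x + y) = f x + f y) -> (forall (t : R) x, f (t%:C * x) = t * f x) ->
  second_derivative_along (f \o eval_zzbar P) v z =
  f (eval_zzbar (dirderiv v (dirderiv v P)) z).
Proof.
move=> fD fZ; rewrite /second_derivative_along.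
have -> : (fun t : R => (f \o eval_zzbar P) (z + t%:C *: v) : R^o) =
    horner (poly_part f (line z v P)).
  by apply/funext => t; rewrite /= -line_horner (horner_poly_part fD fZ).
have f0 : f 0 = 0 by rewrite -(mul0r 0) (fZ 0) mul0r.
rewrite /derive1n /= -!derivE poly_part_deriv2 //; last first.
  by move=> x n; rewrite -mulr_natl -(rmorph_nat (real_complex R)) fZ mulr_natl.
by rewrite !deriv_line -(rmorph0 (real_complex R)) line_horner scale0r addr0.
Qed.

Lemma dirderiv2 j P : dirderiv (e_ j) (dirderiv (e_ j) P)
  + dirderiv (ie_ j) (dirderiv (ie_ j) P) = dz j (dw j P) *+ 4.
Proof.
by rewrite !dirderiv_ie !dirderiv_e; apply: second_mderiv_pair; rewrite mulCii.
Qed.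

Lemma harmonicP P : Defs.harmonic (eval_zzbar P) <-> lap P = 0.
Proof.
have lapE (f : R[i] -> R) z :
   (forall x y, f (x + y) = f x + f y) -> (forall (t : R) x, f (t%:C * x) = t * f x) ->
   laplacian (f \o eval_zzbar P) z = f (eval_zzbar (lap P) z) *+ 4.
  move=> fD fZ; have f0 : f 0 = 0 by rewrite -(mul0r 0) (fZ 0) mul0r.
  rewrite /laplacian /lap eval_sum (big_morph f fD f0) -sumrMnl.
  apply: eq_bigr => j _; rewrite !second_derivative_eval // -fD -evalD dirderiv2.
  rewrite -mulr_natl -mpolyC_nat mul_mpolyC evalZ.
  by rewrite -(rmorph_nat (real_complex R)) fZ mulr_natl.
have ReD (x y : R[i]) : complex.Re (x + y) = complex.Re x + complex.Re y.
  by case: x; case: y.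
have ImD (x y : R[i]) : complex.Im (x + y) = complex.Im x + complex.Im y.
  by case: x; case: y.
have ReZ (t : R) (x : R[i]) : complex.Re (t%:C * x) = t * complex.Re x.
  by case: x => a b /=; rewrite mul0r subr0.
have ImZ (t : R) (x : R[i]) : complex.Im (t%:C * x) = t * complex.Im x.
  by case: x => a b /=; rewrite mul0r addr0.
split=> [hP|lP z]; last by rewrite !lapE // lP eval0 /= mul0rn.
apply: eval_inj => z; have := hP z; rewrite !lapE // => -[/eqP + /eqP].
by rewrite !mulrn_eq0 /= => /eqP r0 /eqP i0; apply/eqP; rewrite eq_complex r0 i0 !eqxx.
Qed.

End evaluation.

(** * Weak*-closed algebras *)

Local Notation normc := (@ComplexField.Normc.normc _).
Local Notation Re := complex.Re.
Local Notation Im := complex.Im.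

Section complex_Lp_theory.
Context {d : measure_display} {T : measurableType d} {R : realType}.
Variable mu : probability T R.
Implicit Types (f g h : T -> R[i]) (c : R[i]).

Lemma ReD (x y : R[i]) : Re (x + y) = Re x + Re y. Proof. by case: x; case: y. Qed.
Lemma ImD (x y : R[i]) : Im (x + y) = Im x + Im y. Proof. by case: x; case: y. Qed.
Lemma ReM (x y : R[i]) : Re (x * y) = Re x * Re y - Im x * Im y.
Proof. by case: x; case: y. Qed.
Lemma ImM (x y : R[i]) : Im (x * y) = Re x * Im y + Im x * Re y.
Proof. by case: x; case: y. Qed.

Lemma normc_ge0 (x : R[i]) : 0 <= normc x.
Proof. by case: x => a b; apply: sqrtr_ge0. Qed.

Lemma norm_Re_le (x : R[i]) : `|Re x| <= normc x.
Proof.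
case: x => a b /=; rewrite -sqrtr_sqr ler_sqrt ?lerDl ?sqr_ge0 //.
by rewrite addr_ge0 ?sqr_ge0.
Qed.

Lemma norm_Im_le (x : R[i]) : `|Im x| <= normc x.
Proof.
case: x => a b /=; rewrite -sqrtr_sqr ler_sqrt ?lerDr ?sqr_ge0 //.
by rewrite addr_ge0 ?sqr_ge0.
Qed.

Lemma normcD_le (x y : R[i]) : normc (x + y) <= normc x + normc y.
Proof. exact: (@le_normcD R). Qed.

Lemma normc_le_ReIm (x : R[i]) : normc x <= `|Re x| + `|Im x|.
Proof.
have -> : x = (Re x)%:C + (0 +i* Im x).
  by case: x => a b; apply/eqP; rewrite eq_complex /= addr0 add0r !eqxx.
apply: le_trans (normcD_le _ _) _; rewrite /= addr0 add0r.
by rewrite !expr0n /= addr0 add0r !sqrtr_sqr.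
Qed.

Lemma cmeasurable_cst c : cmeasurable (fun _ : T => c).
Proof. by split; apply: measurable_cst. Qed.

Lemma cmeasurableD f g : cmeasurable f -> cmeasurable g ->
  cmeasurable (fun x => f x + g x).
Proof.
move=> [f1 f2] [g1 g2]; split.
  rewrite (_ : _ \o _ = (@Re R \o f) \+ (@Re R \o g)).
    exact: measurable_funD.
  by apply/funext => x /=; rewrite ReD.
rewrite (_ : _ \o _ = (@Im R \o f) \+ (@Im R \o g)).
  exact: measurable_funD.
by apply/funext => x /=; rewrite ImD.
Qed.

Lemma cmeasurableM f g : cmeasurable f -> cmeasurable g ->
  cmeasurable (fun x => f x * g x).
Proof.
move=> [f1 f2] [g1 g2]; split.
  rewrite (_ : _ \o _ = ((@Re R \o f) \* (@Re R \o g)) \- ((@Im R \o f) \* (@Im R \o g))).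
    by apply: measurable_funB; apply: measurable_funM.
  by apply/funext => x /=; rewrite ReM.
rewrite (_ : _ \o _ = ((@Re R \o f) \* (@Im R \o g)) \+ ((@Im R \o f) \* (@Re R \o g))).
  by apply: measurable_funD; apply: measurable_funM.
by apply/funext => x /=; rewrite ImM.
Qed.

Lemma measurable_normc f : cmeasurable f -> measurable_fun [set: T] (normc \o f).
Proof.
move=> [f1 f2]; rewrite (_ : _ \o _ = @Num.sqrt R \o
    (fun x => (Re (f x)) ^+ 2 + (Im (f x)) ^+ 2)).
  apply: measurableT_comp.
    by apply: continuous_measurable_fun; exact: sqrt_continuous.
  exact: (measurable_funD (measurable_funX 2 f1) (measurable_funX 2 f2)).
by apply/funext => x /=; case: (f x).
Qed.

Lemma cL1P f : cLp mu 1%E f <->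
  cmeasurable f /\ mu.-integrable [set: T] (EFin \o (normc \o f)).
Proof.
rewrite /cLp /= /finite_norm Lnorm1; split=> -[mf hf]; split => //.
  apply/integrableP; split => //.
  exact/measurable_EFinP/measurable_normc.
by case/integrableP: hf.
Qed.

Lemma cL1_integrable f : cLp mu 1%E f ->
  mu.-integrable [set: T] (EFin \o (@Re R \o f)) /\
  mu.-integrable [set: T] (EFin \o (@Im R \o f)).
Proof.
move=> /cL1P[[f1 f2] hf]; split; apply: le_integrable hf => //.
- exact/measurable_EFinP.
- by move=> x _; rewrite /= lee_fin (ger0_norm (normc_ge0 _)) norm_Re_le.
- exact/measurable_EFinP.
- by move=> x _; rewrite /= lee_fin (ger0_norm (normc_ge0 _)) norm_Im_le.
Qed.

Lemma cLinftyP f : cLp mu +oo%E f <->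
  cmeasurable f /\ exists M : R, {ae mu, forall x, normc (f x) <= M}.
Proof.
have mu1 : (0 < mu [set: T])%E by rewrite probability_setT lte01.
rewrite /cLp /= /finite_norm unlock /= mu1; split=> -[mf hf]; split => //.
  case es : (ess_sup _ _) hf => [M| |] // _.
    exists M; have /ess_supP : (ess_sup mu (abse \o (EFin \o (normc \o f))) <= M%:E)%E.
      by rewrite es.
    by apply: filterS => x; rewrite /= lee_fin ger0_norm ?normc_ge0.
  exists 0; have /ess_supP : (ess_sup mu (abse \o (EFin \o (normc \o f))) <= 0%:E)%E.
    by rewrite es leNye.
  by apply: filterS => x; rewrite /= lee_fin ger0_norm ?normc_ge0.
have [M hM] := hf; apply: (@le_lt_trans _ _ M%:E); last exact: ltry.
apply/ess_supP; apply: filterS hM => x.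
by rewrite /= lee_fin ger0_norm ?normc_ge0.
Qed.

Lemma bounded_cLinfty f (M : R) : cmeasurable f -> (forall x, normc (f x) <= M) ->
  cLp mu +oo%E f.
Proof. by move=> mf hM; apply/cLinftyP; split => //; exists M; apply: aeW. Qed.

Lemma cLinftyD f g : cLp mu +oo%E f -> cLp mu +oo%E g ->
  cLp mu +oo%E (fun x => f x + g x).
Proof.
move=> /cLinftyP[mf [M hM]] /cLinftyP[mg [N hN]]; apply/cLinftyP.
split; first exact: cmeasurableD.
exists (M + N); apply: filterS2 hM hN => x hx kx.
by apply: le_trans (normcD_le _ _) _; apply: lerD.
Qed.

Lemma cLinftyM f g : cLp mu +oo%E f -> cLp mu +oo%E g ->
  cLp mu +oo%E (fun x => f x * g x).
Proof.
move=> /cLinftyP[mf [M hM]] /cLinftyP[mg [N hN]]; apply/cLinftyP.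
split; first exact: cmeasurableM.
exists (M * N); apply: filterS2 hM hN => x hx kx.
by rewrite ComplexField.Normc.normcM; apply: ler_pM => //; apply: normc_ge0.
Qed.

Lemma cLinfty_cst c : cLp mu +oo%E (fun=> c).
Proof. by apply: (@bounded_cLinfty _ (normc c)) => //; exact: cmeasurable_cst. Qed.

Lemma cL1M f g : cLp mu +oo%E f -> cLp mu 1%E g -> cLp mu 1%E (fun x => f x * g x).
Proof.
move=> /cLinftyP[mf [M hM]] /cL1P[mg ig]; apply/cL1P.
have mfg : cmeasurable (fun x => f x * g x) by exact: cmeasurableM.
split => //; apply/integrableP; split; first exact/measurable_EFinP/measurable_normc.
have : mu.-integrable [set: T] (fun x => `|M|%:E * (EFin \o (normc \o g)) x)%E.
  exact: integrableZl.
move=> /integrableP[mMg iMg]; apply: le_lt_trans iMg; apply: ae_ge0_le_integral => //.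
- by apply: measurableT_comp => //; exact/measurable_EFinP/measurable_normc.
- exact: measurableT_comp.
- apply: filterS hM => x hx _; rewrite /= lee_fin ComplexField.Normc.normcM.
  rewrite !normrM !(ger0_norm (normc_ge0 _)) ler_wpM2r ?normc_ge0 //.
  by rewrite normr_id (le_trans hx) // ler_norm.
Qed.

Lemma cLinfty_cL1 f : cLp mu +oo%E f -> cLp mu 1%E f.
Proof.
move=> hf; have h1 : cLp mu 1%E (fun=> 1).
  apply/cL1P; split; first exact: cmeasurable_cst.
  exact: finite_measure_integrable_cst.
by have := cL1M hf h1; congr (cLp _ _ _); apply/funext => x; rewrite mulr1.
Qed.

Lemma cintegralD f g : cLp mu 1%E f -> cLp mu 1%E g ->
  cintegral mu (fun x => f x + g x) = cintegral mu f + cintegral mu g.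
Proof.
move=> /cL1_integrable[f1 f2] /cL1_integrable[g1 g2].
rewrite /cintegral; apply/eqP; rewrite eq_complex /= -!RintegralD //.
by apply/andP; split; apply/eqP; apply: eq_Rintegral => x _; rewrite /= ?ReD ?ImD.
Qed.

Lemma cintegralZ c f : cLp mu 1%E f ->
  cintegral mu (fun x => c * f x) = c * cintegral mu f.
Proof.
move=> /cL1_integrable[f1 f2]; rewrite /cintegral; apply/eqP.
have int_scale (a : R) (h : T -> R) : mu.-integrable [set: T] (EFin \o h) ->
    mu.-integrable [set: T] (EFin \o (fun x => a * h x)).
  by move=> hh; have := integrableZl measurableT a hh.
rewrite eq_complex; case: c => a b /=; rewrite -!RintegralZl //.
rewrite -RintegralB ?int_scale // -RintegralD ?int_scale //.
by apply/andP; split; apply/eqP; apply: eq_Rintegral => x _; rewrite /= ?ReM ?ImM.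
Qed.

Lemma cintegral_cst c : cintegral mu (fun=> c) = c.
Proof.
have e (a : R) : \int[mu]_x a = a.
  have m1 : fine (mu [set: T]) = 1 by rewrite probability_setT.
  by rewrite Rintegral_cst // m1 mulr1.
by rewrite /cintegral !e; case: c.
Qed.

End complex_Lp_theory.

Lemma ptws_continuous (X : topologicalType) (I : Type) (V : topologicalType)
    (h : X -> {ptws I -> V}) :
  (forall i, continuous (fun x => h x i)) -> continuous h.
Proof.
move=> ch x; apply/cvg_sup => i U [? /= [[W oW <-]] /= Whx] /filterS; apply.
by apply: ch; apply: open_nbhs_nbhs.
Qed.

Section weak_star_topology.
Context {d : measure_display} {T : measurableType d} {R : realType}.
Variable mu : probability T R.
Implicit Types (f g h : T -> R[i]) (c : R[i]) (E : set (T -> R[i])).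
Local Notation closure_star := (weak_star_closure mu).

Lemma pairing_continuous (g : cLp mu 1%E) :
  continuous (fun f : weak_star_topology mu => dual_pairing f g).
Proof.
move=> f; apply: (@continuous_comp _ _ _
  (@dual_pairing _ _ _ mu : weak_star_topology mu -> _)
  (fun h : {ptws cLp mu 1%E -> (R[i])^o} => h g)).
  exact: initial_continuous.
exact: (@proj_continuous _ (fun=> (R[i])^o) g).
Qed.

Lemma weak_star_closure_cLinfty E f : closure_star E f -> cLp mu +oo%E f.
Proof. by move=> [F _ <-]; apply: set_valP. Qed.

Lemma weak_star_closureP E f (hf : cLp mu +oo%E f) : closure_star E f <->
  closure ([set h | E (set_val h)] : set (weak_star_topology mu))
    (SigSub (mem_set hf)).
Proof.
split=> [[F hF e]|hF]; last by exists (SigSub (mem_set hf)).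
suff <- : F = SigSub (mem_set hf) by [].
by apply: val_inj.
Qed.

Lemma subset_weak_star_closure E f : cLp mu +oo%E f -> E f -> closure_star E f.
Proof. by move=> hf Ef; apply/(weak_star_closureP _ hf)/subset_closure. Qed.

Lemma weak_star_closure_orthogonal E g f : cLp mu 1%E g ->
  (forall f, cLp mu +oo%E f -> E f -> cintegral mu (fun x => f x * g x) = 0) ->
  closure_star E f -> cintegral mu (fun x => f x * g x) = 0.
Proof.
move=> hg Eg [F hF <-].
pose G : cLp mu 1%E := SigSub (mem_set hg).
pose Z : set (weak_star_topology mu) :=
  (fun f : weak_star_topology mu => dual_pairing f G) @^-1` [set (0 : (R[i])^o)].
have cZ : closed Z.
  apply: closed_comp; first by move=> h _; apply: pairing_continuous.
  exact/accessible_closed_set1/hausdorff_accessible/norm_hausdorff.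
suff : Z F by [].
have : closure Z F.
  by apply: closure_subset hF => h Eh; apply: Eg => //; apply: set_valP.
by rewrite -((closure_id Z).1 cZ).
Qed.

Lemma weak_star_closure_map E (phi : (T -> R[i]) -> T -> R[i]) :
  (forall f, cLp mu +oo%E f -> cLp mu +oo%E (phi f)) ->
  (forall g, cLp mu 1%E g -> exists g' c, cLp mu 1%E g' /\
     forall f, cLp mu +oo%E f -> cintegral mu (fun x => phi f x * g x) =
       cintegral mu (fun x => f x * g' x) + c) ->
  (forall f, cLp mu +oo%E f -> E f -> closure_star E (phi f)) ->
  forall f, closure_star E f -> closure_star E (phi f).
Proof.
move=> phi_bd phi_dual phiE f [F hF <-].
have hphi (G : cLp mu +oo%E) : cLp mu +oo%E (phi (set_val G)).
  by apply: phi_bd; apply: set_valP.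
pose Phi (G : weak_star_topology mu) : weak_star_topology mu :=
  SigSub (mem_set (hphi G)).
have cPhi : continuous Phi.
  apply: continuous_comp_initial; apply: ptws_continuous => g.
  have [g' [c [hg' e]]] := phi_dual _ (set_valP g).
  pose G' : cLp mu 1%E := SigSub (mem_set hg').
  have -> : (fun x : weak_star_topology mu => (@dual_pairing _ _ _ mu \o Phi) x g) =
      (fun x : weak_star_topology mu => (dual_pairing x G' : (R[i])^o) + c).
    by apply/funext => x; apply: e; apply: set_valP.
  move=> x; have hc := @pairing_continuous G' x.
  have cD := @cvgD _ (R[i])^o _ (nbhs x) _
    (fun h : weak_star_topology mu => dual_pairing h G' : (R[i])^o) (cst c)
    (dual_pairing x G') c hc.
  by apply: cD; apply: cvg_cst.
apply/(weak_star_closureP _ (hphi F)).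
rewrite ((closure_id _).1 (@closed_closure _ _)) => U /cPhi /hF [G [EG UG]].
exists (Phi G); split => //.
by apply/(weak_star_closureP _ (hphi G)); apply: phiE => //; apply: set_valP.
Qed.

(* Multiplication is separately weak*-continuous: its transpose is
   multiplication on [L^1]. *)
Lemma weak_star_closure_algebra E : E `<=` cLp mu +oo%E ->
  is_function_algebra E -> is_function_algebra (closure_star E).
Proof.
move=> Ebd [E0 ED EZ EM].
have Ecl f : E f -> closure_star E f.
  by move=> Ef; apply: subset_weak_star_closure => //; apply: Ebd.
have dualM h : cLp mu +oo%E h -> forall g, cLp mu 1%E g -> exists g' c, cLp mu 1%E g' /\
     forall f, cLp mu +oo%E f -> cintegral mu (fun x => f x * h x * g x) =
       cintegral mu (fun x => f x * g' x) + c.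
  move=> hh g hg; exists (fun x => h x * g x), 0; split; first exact: cL1M.
  by move=> f _; rewrite addr0; congr cintegral; apply/funext => x; rewrite mulrA.
have dualD h : cLp mu +oo%E h -> forall g, cLp mu 1%E g -> exists g' c, cLp mu 1%E g' /\
     forall f, cLp mu +oo%E f -> cintegral mu (fun x => (f x + h x) * g x) =
       cintegral mu (fun x => f x * g' x) + c.
  move=> hh g hg; exists g, (cintegral mu (fun x => h x * g x)); split => // f hf.
  rewrite -cintegralD; [|exact: cL1M..].
  by congr cintegral; apply/funext => x; rewrite mulrDl.
have addE f g : closure_star E f -> E g -> closure_star E (fun x => f x + g x).
  move=> hf Eg; have hg := Ebd _ Eg.
  apply: (weak_star_closure_map (phi := fun f x => f x + g x)) hf.
  - by move=> h hh; apply: cLinftyD.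
  - exact: dualD.
  - by move=> h _ Eh; apply/Ecl/ED.
have mulE f g : closure_star E f -> E g -> closure_star E (fun x => f x * g x).
  move=> hf Eg; have hg := Ebd _ Eg.
  apply: (weak_star_closure_map (phi := fun f x => f x * g x)) hf.
  - by move=> h hh; apply: cLinftyM.
  - exact: dualM.
  - by move=> h _ Eh; apply/Ecl/EM.
split.
- exact: Ecl.
- move=> f g hf hg; have gbd := weak_star_closure_cLinfty hg.
  apply: (weak_star_closure_map (phi := fun f x => f x + g x)) hf.
  + by move=> h hh; apply: cLinftyD.
  + exact: dualD.
  + move=> h _ Eh; rewrite (_ : (fun x => _) = (fun x => g x + h x)); first exact: addE.
    by apply/funext => x; rewrite addrC.
- move=> c f hf; rewrite (_ : (fun x => _) = (fun x => f x * c)); last first.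
    by apply/funext => x; rewrite mulrC.
  apply: (weak_star_closure_map (phi := fun f x => f x * c)) hf.
  + by move=> h hh; apply: cLinftyM => //; apply: cLinfty_cst.
  + exact/dualM/cLinfty_cst.
  + move=> h _ Eh; apply: Ecl; rewrite (_ : (fun x => _) = (fun x => c * h x)).
      exact: EZ.
    by apply/funext => x; rewrite mulrC.
- move=> f g hf hg; have gbd := weak_star_closure_cLinfty hg.
  apply: (weak_star_closure_map (phi := fun f x => f x * g x)) hf.
  + by move=> h hh; apply: cLinftyM.
  + exact: dualM.
  + move=> h _ Eh; rewrite (_ : (fun x => _) = (fun x => g x * h x)); first exact: mulE.
    by apply/funext => x; rewrite mulrC.
Qed.

End weak_star_topology.

(** * Integration over the sphere *)

Section sphere_integration.
Variables (R : realType) (m : nat).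
Local Notation Cn := 'rV[(R[i])^o]_m.+1.
Local Notation mp := (mpoly (m.+1 + m.+1) (R[i] : numFieldType)).
Local Notation zv := (@zv R[i] m.+1).
Local Notation wv := (@wv R[i] m.+1).
Local Notation S := (borel_sphere R m).
Implicit Types (P Q : mp) (v : Cn).

Definition on_sphere P (z : S) : R[i] := eval_zzbar P (set_val z).

Lemma complex_normE (x : R[i]) : `|x| = (normc x)%:C.
Proof. by []. Qed.

Lemma Re_continuous : continuous (@Re R : (R[i])^o -> R).
Proof.
move=> x U [e /= e0 eU]; exists e%:C; first by rewrite /= ltcR.
move=> y /=; rewrite complex_normE ltcR => xy; apply: eU; apply: le_lt_trans xy.
by have := norm_Re_le (x - y); rewrite ReD; case: (y).
Qed.

Lemma Im_continuous : continuous (@Im R : (R[i])^o -> R).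
Proof.
move=> x U [e /= e0 eU]; exists e%:C; first by rewrite /= ltcR.
move=> y /=; rewrite complex_normE ltcR => xy; apply: eU; apply: le_lt_trans xy.
by have := norm_Im_le (x - y); rewrite ImD; case: (y).
Qed.

Lemma continuous_measurable_sphere (f : sphere R m -> R) :
  continuous f -> measurable_fun [set: S] f.
Proof.
move=> cf; apply: (measurability _ (RGenOpens.measurableE R)).
move=> _ [_ [a [b ->] <-]]; rewrite setTI; apply: sub_sigma_algebra.
by apply: open_comp => // x _; apply: cf.
Qed.

Lemma set_val_continuous : continuous (set_val : sphere R m -> Cn).
Proof. exact: initial_continuous. Qed.

Lemma coord_cmeasurable j : cmeasurable (fun z : S => set_val z ord0 j : R[i]).
Proof.
have cj : continuous (fun z : sphere R m => set_val z ord0 j).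
  move=> z; apply: (@continuous_comp _ _ _ set_val (fun v : Cn => v ord0 j)).
    exact: set_val_continuous.
  exact: coord_continuous.
split; apply: continuous_measurable_sphere => z.
- by move=> U /Re_continuous /cj.
- by move=> U /Im_continuous /cj.
Qed.

Lemma on_sphere_cmeasurable P : cmeasurable (on_sphere P).
Proof.
elim/mpoly_zw_ind: P => [c|j|j|P Q IP IQ|P Q IP IQ].
- rewrite (_ : on_sphere _ = fun=> c); first exact: cmeasurable_cst.
  by apply/funext => z; rewrite /on_sphere evalC.
- rewrite (_ : on_sphere _ = fun z : S => set_val z ord0 j : R[i]).
    exact: coord_cmeasurable.
  by apply/funext => z; rewrite /on_sphere eval_zv.
- have [hr hi] := coord_cmeasurable j.
  have e (z : S) : on_sphere (wv j) z = conjc (set_val z ord0 j : R[i]).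
    by rewrite /on_sphere eval_wv.
  split; [apply: eq_measurable_fun hr|apply: eq_measurable_fun (measurable_funN hi)];
    by move=> z _; rewrite /= e; case: (set_val z ord0 j : R[i]).
- rewrite (_ : on_sphere _ = fun z => on_sphere P z + on_sphere Q z).
    exact: cmeasurableD.
  by apply/funext => z; rewrite /on_sphere evalD.
- rewrite (_ : on_sphere _ = fun z => on_sphere P z * on_sphere Q z).
    exact: cmeasurableM.
  by apply/funext => z; rewrite /on_sphere evalM.
Qed.

Lemma sphere_coord_le1 (z : Cn) j : unit_sphere z -> normc (z ord0 j : R[i]) <= 1.
Proof.
rewrite /unit_sphere /= /sqnorm => z1.
have : `|z ord0 j : R[i]| ^+ 2 <= 1.
  by rewrite -z1 (bigD1 j) //= lerDl sumr_ge0.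
by rewrite expr_le1 // complex_normE lecR.
Qed.

Lemma eval_bounded P : exists2 M : R, 0 <= M &
  forall z, unit_sphere z -> normc (eval_zzbar P z) <= M.
Proof.
elim/mpoly_zw_ind: P => [c|j|j|P Q [M M0 hM] [N N0 hN]|P Q [M M0 hM] [N N0 hN]].
- by exists (normc c); [exact: normc_ge0|move=> z _; rewrite evalC].
- by exists 1 => // z hz; rewrite eval_zv sphere_coord_le1.
- exists 1 => // z hz; rewrite eval_wv (_ : normc _ = normc (z ord0 j : R[i])).
    exact: sphere_coord_le1.
  by case: (z ord0 j : R[i]) => a b /=; rewrite sqrrN.
- exists (M + N); first exact: addr_ge0.
  move=> z hz; rewrite evalD; apply: le_trans (normcD_le _ _) _.
  by apply: lerD; [apply: hM|apply: hN].
- exists (M * N); first exact: mulr_ge0.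
  move=> z hz; rewrite evalM ComplexField.Normc.normcM.
  by apply: ler_pM; rewrite ?normc_ge0 ?hM ?hN.
Qed.

Variable sigma : probability S R.

Lemma on_sphere_cLinfty P : cLp sigma +oo%E (on_sphere P).
Proof.
have [M _ hM] := eval_bounded P.
apply: (bounded_cLinfty sigma (on_sphere_cmeasurable P)) => z.
by apply: hM; apply: set_valP.
Qed.

Lemma on_sphere_cL1 P : cLp sigma 1%E (on_sphere P).
Proof. exact/cLinfty_cL1/on_sphere_cLinfty. Qed.

Definition mean P : R[i] := cintegral sigma (on_sphere P).

Lemma meanD P Q : mean (P + Q) = mean P + mean Q.
Proof.
rewrite /mean -cintegralD; [|exact: on_sphere_cL1..].
by congr cintegral; apply/funext => z; rewrite /on_sphere evalD.
Qed.

Lemma meanZ c P : mean (c *: P) = c * mean P.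
Proof.
rewrite /mean -cintegralZ; last exact: on_sphere_cL1.
by congr cintegral; apply/funext => z; rewrite /on_sphere evalZ.
Qed.

Lemma mean1 : mean 1 = 1.
Proof.
rewrite -[RHS](cintegral_cst sigma); congr cintegral; apply/funext => z.
by rewrite /on_sphere -mpolyC1 evalC.
Qed.

Lemma mean_sqr_radius P : mean (sqr_radius _ _ * P) = mean P.
Proof.
congr cintegral; apply/funext => z; rewrite /on_sphere evalM eval_sqr_radius.
by have -> : sqnorm (set_val z) = 1 := set_valP z; rewrite mul1r.
Qed.

Lemma normc_cintegral_le (f : S -> R[i]) (M : R) : cLp sigma 1%E f ->
  (forall z, normc (f z) <= M) -> normc (cintegral sigma f) <= M + M.
Proof.
move=> hf hM; have [hr hi] := cL1_integrable hf.
have part (g : S -> R) : sigma.-integrable [set: S] (EFin \o g) ->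
    (forall z, `|g z| <= M) -> `|\int[sigma]_z g z| <= M.
  move=> ig gM; apply: le_trans (le_normr_Rintegral measurableT ig) _.
  have s1 : fine (sigma [set: S]) = 1 by rewrite probability_setT.
  have -> : M = \int[sigma]_z (cst M z) by rewrite Rintegral_cst // s1 mulr1.
  apply: le_Rintegral => //; last exact: finite_measure_integrable_cst.
  exact: (integrable_norm ig).
apply: le_trans (normc_le_ReIm _) _; apply: lerD; apply: part => // z.
  exact: le_trans (norm_Re_le _) (hM z).
exact: le_trans (norm_Im_le _) (hM z).
Qed.

End sphere_integration.

Section complex_reflections.
Variables (R : realType) (m : nat).
Local Notation Cn := 'rV[(R[i])^o]_m.+1.
Implicit Types (z w v : Cn) (a b c : R[i]).

Definition inner z w : R[i] :=
  \sum_(j < m.+1) (z ord0 j : R[i]) * conjc (w ord0 j : R[i]).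

Lemma conjc_sum (I : Type) (s : seq I) (F : I -> R[i]) :
  conjc (\sum_(i <- s) F i) = \sum_(i <- s) conjc (F i).
Proof. by apply: (big_morph _ (@conjcD R)); rewrite conjc0. Qed.

Lemma inner_conj z w : conjc (inner z w) = inner w z.
Proof.
rewrite /inner conjc_sum; apply: eq_bigr => j _.
by rewrite conjcM conjcK; apply: mulrC.
Qed.

Lemma inner_sqnorm z : inner z z = sqnorm z.
Proof. by apply: eq_bigr => j _; rewrite sqr_normc. Qed.

Lemma inner_lineD z w v c : inner (z + c *: w) v = inner z v + c * inner w v.
Proof.
rewrite /inner mulr_sumr -big_split; apply: eq_bigr => j _ /=.
by rewrite line_entry mulrDl mulrA.
Qed.

Lemma inner_lineD_r z w v c :
  inner v (z + c *: w) = inner v z + conjc c * inner v w.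
Proof.
by rewrite -inner_conj inner_lineD conjcD conjcM !inner_conj.
Qed.

Definition reflection a v z : Cn := z + (a * inner z v) *: v.

(* The hypothesis says that [1 + a * sqnorm v] has modulus [1]. *)
Lemma sqnorm_reflection a v z :
  a + conjc a + a * conjc a * sqnorm v = 0 -> sqnorm (reflection a v z) = sqnorm z.
Proof.
move=> ha; rewrite -!inner_sqnorm inner_lineD !inner_lineD_r conjcM.
rewrite inner_conj (inner_sqnorm v).
have -> : inner z z + conjc a * inner v z * inner z v + a * inner z v *
    (inner v z + conjc a * inner v z * sqnorm v) =
  inner z z + (a + conjc a + a * conjc a * sqnorm v) * (inner v z * inner z v).
  by move: (inner _ _) (inner _ _) (inner _ _) (sqnorm _) (conjc a) => *; ring.
by rewrite ha mul0r addr0.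
Qed.

Lemma reflectionK a b v :
  a + b + a * b * sqnorm v = 0 -> cancel (reflection b v) (reflection a v).
Proof.
move=> hab z; rewrite /reflection inner_lineD inner_sqnorm -addrA -scalerDl.
have -> : b * inner z v + a * (inner z v + b * inner z v * sqnorm v) =
    (a + b + a * b * sqnorm v) * inner z v.
  by move: (inner _ _) (sqnorm _) => *; ring.
by rewrite hab mul0r scale0r addr0.
Qed.

Lemma reflection_orthogonal a v :
  a + conjc a + a * conjc a * sqnorm v = 0 -> orthogonal_map (reflection a v).
Proof.
move=> ha; split=> [z w|t z|z]; last exact: sqnorm_reflection.
  have innerD : inner (z + w) v = inner z v + inner w v.
    by have := inner_lineD z w v 1; rewrite scale1r mul1r.
  rewrite /reflection innerD mulrDr.
  by rewrite scalerDl addrACA.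
have innerZ : inner (t%:C *: z) v = t%:C * inner z v.
  have inner0 : inner 0 v = 0 by rewrite /inner big1 // => j _; rewrite mxE mul0r.
  by have := inner_lineD 0 z v t%:C; rewrite add0r inner0 add0r.
by rewrite /reflection innerZ scalerDr scalerA mulrCA.
Qed.

Lemma inner_continuous v : continuous (fun z => inner z v : (R[i])^o).
Proof.
apply: continuous_big => [|j _ z]; first exact: add_continuous.
have cj : continuous (fun z : Cn => z ord0 j) by exact: coord_continuous.
have := @cvgMr_tmp _ _ _ _ (fun z : Cn => z ord0 j) _
  (conjc (v ord0 j : R[i])) (cj z).
exact.
Qed.

Lemma reflection_continuous a v : continuous (reflection a v).
Proof.
move=> z; have ci : inner w v @[w --> z] --> (inner z v : (R[i])^o).
  exact: inner_continuous.
have FF : Filter (nbhs z) by exact: nbhs_filter.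
have ca := @cvgMl_tmp _ _ _ FF _ a _ ci.
have cs := @cvgZr_tmp _ Cn _ _ FF _ _ v ca.
have cd := @cvgD _ Cn _ _ FF _ _ _ _ (@cvg_id _ (nbhs z)) cs.
exact: cd.
Qed.

End complex_reflections.

Section rotation_invariance.
Variables (R : realType) (m : nat).
Local Notation Cn := 'rV[(R[i])^o]_m.+1.
Local Notation mp := (mpoly (m.+1 + m.+1) (R[i] : numFieldType)).
Local Notation zv := (@zv R[i] m.+1).
Local Notation wv := (@wv R[i] m.+1).
Local Notation S := (borel_sphere R m).
Implicit Types (P Q : mp) (v : Cn) (a b : R[i]).
Variable sigma : probability S R.
Hypothesis sigma_inv : rotation_invariant sigma.

Lemma Rintegral_rotation (u : S -> S) (f : S -> R) :
  measurable_fun [set: S] u ->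
  (forall A, measurable A -> sigma (u @^-1` A) = sigma A) ->
  measurable_fun [set: S] f ->
  sigma.-integrable [set: S] (EFin \o (f \o u)) ->
  \int[sigma]_z f (u z) = \int[sigma]_z f z.
Proof.
move=> mu su mf ifu; congr fine.
have mEf : measurable_fun [set: S] (EFin \o f) by exact/measurable_EFinP.
have := integral_pushforward mu (mu := sigma) (D := [set: S]) mEf ifu measurableT.
rewrite preimage_setT => e; apply: etrans (esym e) _.
by apply: eq_measure_integral => A mA _; apply: su.
Qed.

Lemma orthogonal_map_sphere (U : Cn -> Cn) (z : S) :
  orthogonal_map U -> unit_sphere (U (set_val z)).
Proof. by move=> [_ _ nU]; rewrite /unit_sphere /= nU; apply: (set_valP z). Qed.

Definition rotation (U : Cn -> Cn) (oU : orthogonal_map U) (z : S) : S :=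
  SigSub (mem_set (orthogonal_map_sphere z oU)).

Lemma rotation_measurable (U : Cn -> Cn) (oU : orthogonal_map U) :
  continuous U -> measurable_fun [set: S] (rotation oU).
Proof.
move=> cU; have cu : continuous (rotation oU : sphere R m -> sphere R m).
  apply: continuous_comp_initial => z.
  apply: (@continuous_comp _ _ _ set_val U); first exact: set_val_continuous.
  exact: cU.
apply: (@measurability _ _ S S _ _ (@open (sphere R m)) erefl).
move=> _ [A oA <-]; rewrite setTI; apply: sub_sigma_algebra.
by apply: open_comp => // x _; apply: cu.
Qed.

Lemma rotation_cLinfty (U : Cn -> Cn) P : orthogonal_map U -> continuous U ->
  cLp sigma +oo%E (fun z : S => eval_zzbar P (U (set_val z))).
Proof.
move=> oU cU; have mu := rotation_measurable oU cU.
have [M _ hM] := eval_bounded P; have [mr mi] := on_sphere_cmeasurable P.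
apply: (@bounded_cLinfty _ _ _ _ _ M) => [|z].
  by split; [exact: (measurableT_comp mr mu)|exact: (measurableT_comp mi mu)].
exact: (hM _ (set_valP (rotation oU z))).
Qed.

Lemma mean_rotation (U V : Cn -> Cn) P :
  orthogonal_map U -> orthogonal_map V -> continuous U ->
  cancel U V -> cancel V U ->
  cintegral sigma (fun z => eval_zzbar P (U (set_val z))) = mean sigma P.
Proof.
move=> oU oV cU UK VK; have mu := rotation_measurable oU cU.
have su A : measurable A -> sigma (rotation oU @^-1` A) = sigma A.
  move=> mA; rewrite -(sigma_inv oV mA); congr (sigma _).
  apply/seteqP; split=> z /=.
    by move=> Auz; exists (rotation oU z) => //; rewrite /= UK.
  move=> [w Aw e]; have -> : rotation oU z = w by apply: val_inj; rewrite /= e VK.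
  exact: Aw.
have [hr hi] := cL1_integrable (cLinfty_cL1 (rotation_cLinfty P oU cU)).
have [mr mi] := on_sphere_cmeasurable P.
apply/eqP; rewrite eq_complex; apply/andP; split; apply/eqP.
  exact: (Rintegral_rotation mu su mr hr).
exact: (Rintegral_rotation mu su mi hi).
Qed.

Lemma mean_reflection a v P :
  a + conjc a + a * conjc a * sqnorm v = 0 ->
  cintegral sigma (fun z => eval_zzbar P (reflection a v (set_val z))) =
  mean sigma P.
Proof.
move=> ha; have hb : conjc a + conjc (conjc a) + conjc a * conjc (conjc a) * sqnorm v = 0.
  by rewrite conjcK (addrC _ a) (mulrC _ a).
apply: (@mean_rotation _ (reflection (conjc a) v)).
- exact: reflection_orthogonal.
- exact: reflection_orthogonal.
- exact: reflection_continuous.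
- by apply: reflectionK; rewrite conjcK in hb.
- exact: reflectionK.
Qed.

End rotation_invariance.

Section first_order_bounds.
Variable R : realType.
Implicit Types (A B p q t : R[i]) (s c d M N : R).

Lemma first_orderD_bound t A B p q p' q' c d :
  normc (A - p - t * p') <= c -> normc (B - q - t * q') <= d ->
  normc (A + B - (p + q) - t * (p' + q')) <= c + d.
Proof.
move=> hA hB; apply: le_trans (lerD hA hB); apply: le_trans (normcD_le _ _).
suff -> : A + B - (p + q) - t * (p' + q') = A - p - t * p' + (B - q - t * q') by [].
by ring.
Qed.

Lemma first_orderM_bound s A B p q p' q' C D MQ MP NP NQ : 0 <= s <= 1 ->
  normc (A - p - s%:C * p') <= C * s ^+ 2 ->
  normc (B - q - s%:C * q') <= D * s ^+ 2 ->
  normc B <= MQ -> normc p <= MP -> normc p' <= NP -> normc q' <= NQ ->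
  normc (A * B - p * q - s%:C * (p' * q + p * q')) <=
    (C * MQ + (MP + NP) * D + NP * NQ) * s ^+ 2.
Proof.
move=> /andP[s0 s1] hA hB hB0 hp hp' hq'.
have ns : normc (s%:C) = s by rewrite /= expr0n addr0 sqrtr_sqr ger0_norm.
have -> : A * B - p * q - s%:C * (p' * q + p * q') =
   (A - p - s%:C * p') * B + (p + s%:C * p') * (B - q - s%:C * q')
   + s%:C * s%:C * (p' * q').
  by ring.
have -> : (C * MQ + (MP + NP) * D + NP * NQ) * s ^+ 2 =
    C * s ^+ 2 * MQ + (MP + NP) * (D * s ^+ 2) + s ^+ 2 * (NP * NQ) by ring.
apply: le_trans (normcD_le _ _) _; apply: lerD; last first.
  rewrite !ComplexField.Normc.normcM ns -expr2.
  by apply: ler_wpM2l; rewrite ?sqr_ge0 //; apply: ler_pM; rewrite ?normc_ge0.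
apply: le_trans (normcD_le _ _) _; rewrite !ComplexField.Normc.normcM; apply: lerD.
  by apply: ler_pM; rewrite ?normc_ge0.
apply: ler_pM; rewrite ?normc_ge0 //.
apply: le_trans (normcD_le _ _) _; apply: lerD => //.
rewrite ComplexField.Normc.normcM ns; apply: le_trans hp'.
by rewrite ler_piMl ?normc_ge0.
Qed.

End first_order_bounds.

Section infinitesimal_rotation.
Variables (R : realType) (m : nat).
Local Notation Cn := 'rV[(R[i])^o]_m.+1.
Local Notation mp := (mpoly (m.+1 + m.+1) (R[i] : numFieldType)).
Local Notation zv := (@zv R[i] m.+1).
Local Notation wv := (@wv R[i] m.+1).
Local Notation S := (borel_sphere R m).
Implicit Types (P Q : mp) (a b : R[i]).
Variables (v : Cn) (nu : R).
Hypothesis nu_gt0 : 0 < nu.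
Hypothesis sqnorm_v : sqnorm v = nu%:C.

(* [reflection (angle s) v] multiplies [v] by the unimodular number
   [sqrt (1 - s^2) + i s]. *)
Definition angle (s : R) : R[i] := ((Num.sqrt (1 - s ^+ 2) - 1) / nu) +i* (s / nu).

Lemma angle_unitary (s : R) : 0 <= s <= 1 ->
  angle s + conjc (angle s) + angle s * conjc (angle s) * sqnorm v = 0.
Proof.
move=> /andP[s0 s1]; rewrite sqnorm_v /angle.
have : Num.sqrt (1 - s ^+ 2) ^+ 2 = 1 - s ^+ 2.
  by rewrite sqr_sqrtr // subr_ge0 expr_le1.
move: (Num.sqrt _) => c hc; have nu0 : nu != 0 by rewrite gt_eqF.
apply/eqP; rewrite eq_complex /=; apply/andP; split; apply/eqP; last by field.
have -> : (c - 1) / nu + (c - 1) / nu + (((c - 1) / nu * ((c - 1) / nu) -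
    s / nu * - (s / nu)) * nu - ((c - 1) / nu * - (s / nu) + s / nu * ((c - 1) / nu)) * 0)
  = (c ^+ 2 - (1 - s ^+ 2)) / nu by field.
by rewrite hc subrr mul0r.
Qed.

Lemma sqrt_1B_sqr (s : R) : 0 <= s <= 1 ->
  `|Num.sqrt (1 - s ^+ 2) - 1| <= s ^+ 2.
Proof.
move=> /andP[s0 s1]; have h0 : 0 <= 1 - s ^+ 2 by rewrite subr_ge0 expr_le1.
have := sqr_sqrtr h0; have := sqrtr_ge0 (1 - s ^+ 2).
move: (Num.sqrt _) => c c0 hc; have c1 : c <= 1.
  by rewrite -(@expr_le1 _ 2) // hc gerBl sqr_ge0.
rewrite ler0_norm ?subr_le0 // opprB; have -> : s ^+ 2 = 1 - c ^+ 2 by rewrite hc; ring.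
by rewrite lerD2l lerN2 expr2 ler_piMr.
Qed.

Definition inner_poly : mp :=
  \sum_(k < m.+1) mpolyC _ (conjc (v ord0 k : R[i])) * zv k.
Definition inner_poly_conj : mp :=
  \sum_(k < m.+1) mpolyC _ (v ord0 k : R[i]) * wv k.

Lemma eval_inner_poly z : eval_zzbar inner_poly z = inner z v.
Proof.
rewrite /inner_poly eval_sum; apply: eq_bigr => k _.
by rewrite evalM evalC eval_zv; apply: mulrC.
Qed.

Lemma eval_inner_poly_conj z : eval_zzbar inner_poly_conj z = conjc (inner z v).
Proof.
rewrite /inner_poly_conj eval_sum conjc_sum; apply: eq_bigr => k _.
by rewrite evalM evalC eval_wv conjcM conjcK; apply: mulrC.
Qed.

Let h : R[i] := 0 +i* nu^-1.

Definition generator : mp -> mp := mderiv_along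
  (fun j => mpolyC _ (h * (v ord0 j : R[i])) * inner_poly)
  (fun j => mpolyC _ (conjc (h * (v ord0 j : R[i]))) * inner_poly_conj).

Lemma normc_conj (x : R[i]) : normc (conjc x) = normc x.
Proof. by case: x => a b /=; rewrite sqrrN. Qed.

Let U s := reflection (angle s) v.

Let first_order P := exists2 C : R, 0 <= C & forall s z, 0 <= s <= 1 ->
  unit_sphere z ->
  normc (eval_zzbar P (U s z) - eval_zzbar P z
         - s%:C * eval_zzbar (generator P) z) <= C * s ^+ 2.

Let U_sphere s z : 0 <= s <= 1 -> unit_sphere z -> unit_sphere (U s z).
Proof.
by move=> hs hz; rewrite /unit_sphere /= /U sqnorm_reflection // angle_unitary.
Qed.

Let U_coord s z j : (U s z) ord0 j =
  (z ord0 j : R[i]) + angle s * inner z v * (v ord0 j : R[i]) :> R[i].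
Proof. exact: line_entry. Qed.

Let angle_sub s x : angle s * x - s%:C * (h * x) =
  ((Num.sqrt (1 - s ^+ 2) - 1) / nu)%:C * x.
Proof.
rewrite mulrA -mulrBl; congr (_ * _); apply/eqP; rewrite eq_complex /=.
by apply/andP; split; apply/eqP; ring.
Qed.

Lemma first_order_coord j : exists2 C : R, 0 <= C & forall s (z : Cn), 0 <= s <= 1 ->
  unit_sphere z ->
  normc ((U s z) ord0 j - (z ord0 j : R[i])
    - s%:C * (h * (v ord0 j : R[i]) * inner z v)) <= C * s ^+ 2.
Proof.
have [M M0 hM] := eval_bounded (inner_poly * mpolyC _ (v ord0 j : R[i])).
exists (nu^-1 * M) => [|s z hs hz]; first by rewrite mulr_ge0 // invr_ge0 ltW.
rewrite U_coord.
have -> : (z ord0 j : R[i]) + angle s * inner z v * (v ord0 j : R[i]) - (z ord0 j : R[i])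
    - s%:C * (h * (v ord0 j : R[i]) * inner z v) =
    ((Num.sqrt (1 - s ^+ 2) - 1) / nu)%:C * (inner z v * (v ord0 j : R[i])).
  rewrite -angle_sub.
  by move: (inner z v) (z ord0 j : R[i]) (v ord0 j : R[i]) (angle s) => *; ring.
have := hM _ hz; rewrite evalM evalC eval_inner_poly => hb.
rewrite ComplexField.Normc.normcM.
have -> : normc ((Num.sqrt (1 - s ^+ 2) - 1) / nu)%:C =
   `|Num.sqrt (1 - s ^+ 2) - 1| / nu.
  by rewrite /= expr0n addr0 sqrtr_sqr normrM (ger0_norm (x := nu^-1)) // invr_ge0 ltW.
rewrite [_ / nu]mulrC -!mulrA ler_wpM2l ?invr_ge0 ?(ltW nu_gt0) // [leRHS]mulrC.
by apply: ler_pM; [exact: normr_ge0|exact: normc_ge0|exact: sqrt_1B_sqr|exact: hb].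
Qed.

Lemma first_orderP P : first_order P.
Proof.
elim/mpoly_zw_ind: P => [c|j|j|P Q [C C0 hC] [D D0 hD]|P Q [C C0 hC] [D D0 hD]].
- exists 0 => // s z hs hz; rewrite !evalC /generator mderiv_alongC eval0.
  by rewrite subrr mulr0 subr0 ComplexField.Normc.normc0 mul0r.
- have [C C0 hC] := first_order_coord j; exists C => // s z hs hz.
  rewrite !eval_zv /generator mderiv_along_zv evalM evalC eval_inner_poly.
  exact: hC.
- have [C C0 hC] := first_order_coord j; exists C => // s z hs hz.
  rewrite !eval_wv /generator mderiv_along_wv evalM evalC eval_inner_poly_conj.
  have := hC s z hs hz; rewrite -normc_conj.
  have conjcB (x y : R[i]) : conjc (x - y) = conjc x - conjc y.
    exact: (rmorphB (@conjc R)).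
  by rewrite !conjcB (conjcM s%:C) (conjcM _ (inner z v)) conjc_real.
- exists (C + D) => [|s z hs hz]; first exact: addr_ge0.
  have -> : generator (P + Q) = generator P + generator Q by exact: mderiv_alongD.
  rewrite !evalD mulrDl; apply: first_orderD_bound; first exact: hC.
  exact: hD.
- have [MQ MQ0 hMQ] := eval_bounded Q.
  have [MP MP0 hMP] := eval_bounded P.
  have [NP NP0 hNP] := eval_bounded (generator P).
  have [NQ NQ0 hNQ] := eval_bounded (generator Q).
  exists (C * MQ + (MP + NP) * D + NP * NQ) => [|s z hs hz].
    by rewrite !(addr_ge0, mulr_ge0).
  have -> : generator (P * Q) = generator P * Q + P * generator Q.
    exact: mderiv_alongM.
  rewrite !evalD !evalM.
  exact: (first_orderM_bound hs (hC s z hs hz) (hD s z hs hz)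
    (hMQ _ (U_sphere hs hz)) (hMP _ hz) (hNP _ hz) (hNQ _ hz)).
Qed.

Variable sigma : probability S R.
Hypothesis sigma_inv : rotation_invariant sigma.

(* The terms of first order in [s] of an integral that does not depend on [s]. *)
Lemma mean_generator P : mean sigma (generator P) = 0.
Proof.
have [C C0 hC] := first_orderP P.
have bound s : 0 < s <= 1 -> normc (mean sigma (generator P)) <= (C + C) * s.
  move=> /andP[s0 s1]; have hs : 0 <= s <= 1 by rewrite ltW.
  have oU := reflection_orthogonal (angle_unitary hs).
  have hbd : cLp sigma +oo%E (fun z : S => eval_zzbar P (U s (set_val z))).
    by apply: rotation_cLinfty => //; apply: reflection_continuous.
  pose f (z : S) : R[i] := eval_zzbar P (U s (set_val z)) +
    on_sphere ((- 1 : R[i]) *: P + (- s%:C : R[i]) *: generator P) z.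
  have fE z : f z = eval_zzbar P (U s (set_val z)) - eval_zzbar P (set_val z)
      - s%:C * eval_zzbar (generator P) (set_val z).
    by rewrite /f /on_sphere evalD !evalZ mulN1r mulNr addrA.
  have If : cintegral sigma f = - s%:C * mean sigma (generator P).
    rewrite cintegralD; [|exact: cLinfty_cL1|exact: on_sphere_cL1].
    rewrite (mean_reflection sigma_inv P (angle_unitary hs)).
    by rewrite -/(mean _ _) meanD !meanZ mulN1r addNKr.
  have := @normc_cintegral_le _ _ sigma f (C * s ^+ 2).
  rewrite If ComplexField.Normc.normcM.
  have -> : normc (- s%:C) = s.
    by rewrite /= oppr0 expr0n addr0 sqrtr_sqr normrN gtr0_norm.
  have -> : C * s ^+ 2 + C * s ^+ 2 = s * ((C + C) * s) by ring.
  rewrite ler_pM2l //; apply.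
    by apply/cLinfty_cL1/cLinftyD => //; apply: on_sphere_cLinfty.
  by move=> z; rewrite fE; apply: hC => //; apply: (set_valP z).
apply/ComplexField.Normc.eq0_normc/eqP; rewrite eq_le normc_ge0 andbT.
apply/ler_addgt0Pl => e e0; rewrite addr0.
pose s := Num.min 1 (e / (C + C + 1)).
have C1 : 0 < C + C + 1 by rewrite ltr_wpDl // addr_ge0.
have s0 : 0 < s by rewrite lt_min ltr01 divr_gt0.
apply: le_trans (bound s _) _; first by rewrite s0 ge_min lexx.
have : s <= e / (C + C + 1) by rewrite ge_min lexx orbT.
rewrite ler_pdivlMr // mulrC; apply: le_trans.
by rewrite ler_pM2r // lerDl.
Qed.

End infinitesimal_rotation.

Section mean_invariance.
Variables (R : realType) (m : nat).
Local Notation Cn := 'rV[(R[i])^o]_m.+1.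
Local Notation mp := (mpoly (m.+1 + m.+1) (R[i] : numFieldType)).
Local Notation zv := (@zv R[i] m.+1).
Local Notation wv := (@wv R[i] m.+1).
Implicit Types (P Q : mp).
Variable sigma : probability (borel_sphere R m) R.
Hypothesis sigma_inv : rotation_invariant sigma.
Local Notation L := (mean sigma).

Lemma sesquilinear_eq0 (B : 'I_m.+1 -> 'I_m.+1 -> R[i]) :
  (forall (v : Cn) (nu : R), 0 < nu -> sqnorm v = nu%:C ->
    \sum_j \sum_k (v ord0 j : R[i]) * conjc (v ord0 k : R[i]) * B j k = 0) ->
  forall j k, B j k = 0.
Proof.
move=> hB; pose e_ l : Cn := delta_mx ord0 l.
have e_E l t : (e_ l) ord0 t = (t == l)%:R :> R[i] by rewrite mxE eqxx.
have sum_e l (F : 'I_m.+1 -> R[i]) :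
    \sum_t ((e_ l) ord0 t : R[i]) * F t = F l.
  rewrite (bigD1 l) //= big1 ?addr0 => [|t tl]; first by rewrite e_E eqxx mul1r.
  by rewrite e_E (negbTE tl) mul0r.
have conj_e l t : conjc ((e_ l) ord0 t : R[i]) = (e_ l) ord0 t.
  by rewrite e_E; case: eqP; rewrite ?conjc1 ?conjc0.
have inner_e l t : inner (e_ l) (e_ t) = (l == t)%:R.
  rewrite /inner (eq_bigr (fun s => ((e_ l) ord0 s : R[i]) * (s == t)%:R)).
    exact: sum_e.
  by move=> s _; rewrite conj_e (e_E t).
have diag l : B l l = 0.
  have : sqnorm (e_ l) = (1 : R)%:C by rewrite -inner_sqnorm inner_e eqxx.
  move/(hB _ _ ltr01); rewrite (eq_bigr (fun s =>
    ((e_ l) ord0 s : R[i]) * \sum_t ((e_ l) ord0 t : R[i]) * B s t)).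
    by rewrite sum_e sum_e.
  move=> s _; rewrite mulr_sumr; apply: eq_bigr => t _.
  by rewrite conj_e mulrA.
move=> k j; case: (eqVneq k j) => [->|kj]; first exact: diag.
have offdiag (c : R[i]) : c * conjc c = 1 ->
    conjc c * B k j + c * B j k = 0.
  move=> cc; have : sqnorm (e_ k + c *: e_ j) = (2%:R : R)%:C.
    rewrite -inner_sqnorm inner_lineD !inner_lineD_r !inner_e !eqxx.
    rewrite (eq_sym j k) (negbTE kj) !mulr0 addr0 add0r mulr1 cc.
    by rewrite rmorph_nat.
  move/(hB _ _ (ltr0Sn _ 1)).
  have sum_v (F : 'I_m.+1 -> R[i]) :
      \sum_t ((e_ k + c *: e_ j) ord0 t : R[i]) * F t = F k + c * F j.
    rewrite (eq_bigr (fun t => ((e_ k) ord0 t : R[i]) * F t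
      + c * (((e_ j) ord0 t : R[i]) * F t))).
      by rewrite big_split /= -mulr_sumr !sum_e.
    by move=> t _; rewrite line_entry mulrDl mulrA.
  have sum_cv (F : 'I_m.+1 -> R[i]) :
      \sum_t conjc ((e_ k + c *: e_ j) ord0 t : R[i]) * F t = F k + conjc c * F j.
    rewrite (eq_bigr (fun t => ((e_ k) ord0 t : R[i]) * F t
      + conjc c * (((e_ j) ord0 t : R[i]) * F t))).
      by rewrite big_split /= -mulr_sumr !sum_e.
    by move=> t _; rewrite line_entry conjcD conjcM !conj_e mulrDl mulrA.
  rewrite (eq_bigr (fun s => ((e_ k + c *: e_ j) ord0 s : R[i]) *
    \sum_t conjc ((e_ k + c *: e_ j) ord0 t : R[i]) * B s t)).
    rewrite (sum_v (fun s => \sum_t conjc ((e_ k + c *: e_ j) ord0 t : R[i]) * B s t)).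
    by rewrite (sum_cv (B k)) (sum_cv (B j)) !diag add0r mulr0 addr0.
  by move=> s _; rewrite mulr_sumr; apply: eq_bigr => t _; rewrite mulrA.
have o1 : B k j + B j k = 0.
  by have := offdiag 1; rewrite conjc1 !mul1r; apply.
have oi : (- (0 +i* 1) : R[i]) * B k j + (0 +i* 1 : R[i]) * B j k = 0.
  have ci : conjc (0 +i* 1 : R[i]) = - (0 +i* 1).
    by apply/eqP; rewrite eq_complex /= oppr0 !eqxx.
  rewrite -ci; apply: offdiag; rewrite ci; apply/eqP; rewrite eq_complex /=.
  by apply/andP; split; apply/eqP; ring.
move: oi; rewrite mulNr addrC -mulrBr => /eqP; rewrite mulf_eq0 eq_complex /=.
rewrite oner_eq0 andbF /= subr_eq0 => /eqP e; move: o1; rewrite e -mulr2n => /eqP.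
by rewrite mulrn_eq0 => /eqP.
Qed.

Lemma mean_generator_form (v : Cn) (nu : R) P : 0 < nu -> sqnorm v = nu%:C ->
  \sum_j \sum_k (v ord0 j : R[i]) * conjc (v ord0 k : R[i]) * 
    (L (zv k * dz j P) - L (wv j * dw k P)) = 0.
Proof.
move=> nu0 hv; pose h : R[i] := 0 +i* nu^-1.
have h0 : h != 0 by rewrite eq_complex /= eqxx /= invr_eq0 gt_eqF.
have conjh : conjc h = - h by apply/eqP; rewrite eq_complex /= oppr0 !eqxx.
have eW : (fun j => mpolyC _ (conjc (h * (v ord0 j : R[i]))) * inner_poly_conj v) =
    (fun j => mpolyC _ (- h * conjc (v ord0 j : R[i])) * inner_poly_conj v) :> (_ -> mp).
  by apply/funext => j; rewrite conjcM conjh.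
have hG := mean_generator nu0 hv sigma_inv P.
rewrite /generator -/h eW in hG.
exact: (functional_rank_one (meanD sigma) (meanZ sigma) h0 hG).
Qed.

Lemma mean_derivation j k P : L (zv j * dz k P) = L (wv k * dw j P).
Proof.
apply/eqP; rewrite -subr_eq0; apply/eqP.
apply: (@sesquilinear_eq0 (fun j k => L (zv k * dz j P) - L (wv j * dw k P))).
by move=> v nu nu0 hv; apply: (mean_generator_form P nu0 hv).
Qed.

End mean_invariance.

(** * Algebra patterns *)

Section harmonic_spans.
Variables (R : realType) (m : nat).
Local Notation mp := (mpoly (m.+1 + m.+1) (R[i] : numFieldType)).
Local Notation S := (borel_sphere R m).
Implicit Types (P Q : mp) (f g : sphere R m -> R[i]) (Omega : set (nat * nat)).

Lemma HpqP p q f : Hpq p q f <->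
  exists P : mp, [/\ bihom p q P, lap P = 0 & f = on_sphere P].
Proof.
split=> -[P [hP lP fP]]; exists P; split => //.
- exact/harmonicP.
- exact/funext.
- exact/harmonicP.
- by move=> z; rewrite fP.
Qed.

Lemma E_ext Omega f g : (forall z, f z = g z) -> E_ Omega f -> E_ Omega g.
Proof. by move/funext => ->. Qed.

Lemma E0 Omega : E_ Omega (fun _ : sphere R m => 0).
Proof.
exists 0%N, (fun _ _ => 0); split=> [[]//|z]; first by rewrite big_ord0.
Qed.

Lemma E_Hpq Omega p q f : Omega (p, q) -> Hpq p q f -> E_ Omega f.
Proof.
move=> hpq hf; exists 1%N, (fun=> f); split=> [_|z]; first by exists (p, q).
by rewrite big_ord1.
Qed.

Lemma E_add Omega f g : E_ Omega f -> E_ Omega g -> E_ Omega (fun z => f z + g z).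
Proof.
move=> [k [h [hh ef]]] [l [h' [hh' eg]]].
exists (k + l)%N, (fun i => match fintype.split i with inl a => h a | inr b => h' b end).
split=> [i|z]; first by case: (fintype.split i).
rewrite big_split_ord ef eg; congr (_ + _); apply: eq_bigr => i _.
  by rewrite (unsplitK (inl i)).
by rewrite (unsplitK (inr i)).
Qed.

Lemma E_sum Omega (I : Type) (s : seq I) (Pr : pred I) (F : I -> sphere R m -> R[i]) :
  (forall i, Pr i -> E_ Omega (F i)) ->
  E_ Omega (fun z => \sum_(i <- s | Pr i) F i z).
Proof.
move=> hF; elim: s => [|i s IH].
  by apply: E_ext (E0 Omega) => z; rewrite big_nil.
case Pi : (Pr i); last by apply: E_ext IH => z; rewrite big_cons Pi.
by apply: E_ext (E_add (hF i Pi) IH) => z; rewrite big_cons Pi.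
Qed.

Lemma E_ind Omega (Pr : (sphere R m -> R[i]) -> Prop) : Pr (fun=> 0) ->
  (forall f g, Pr f -> Pr g -> Pr (fun z => f z + g z)) ->
  (forall p q f, Omega (p, q) -> Hpq p q f -> Pr f) ->
  forall f, E_ Omega f -> Pr f.
Proof.
move=> P0 PD PH f [k [h [hh ef]]].
have -> : f = fun z => \sum_(i < k) h i z by apply/funext.
elim: k h hh {ef} => [|k IH] h hh.
  rewrite (_ : (fun z => _) = fun=> 0) //.
  by apply/funext => z; rewrite big_ord0.
rewrite (_ : (fun z => _) =
    fun z => \sum_(i < k) h (widen_ord (leqnSn k) i) z + h ord_max z); last first.
  by apply/funext => z; rewrite big_ord_recr.
apply: PD; first exact: IH.
by have [[p q] hpq hH] := hh ord_max; apply: PH hpq hH.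
Qed.

Lemma Hpq_scale p q (c : R[i]) f : Hpq p q f -> Hpq p q (fun z => c * f z).
Proof.
move=> /HpqP[P [hP lP ->]]; apply/HpqP; exists (c *: P); split.
- exact: bihomZ.
- by rewrite lapZ lP scaler0.
- by apply/funext => z; rewrite /on_sphere evalZ.
Qed.

Lemma E_scale Omega c f : E_ Omega f -> E_ Omega (fun z => c * f z).
Proof.
move: f; apply: E_ind => [|f g hf hg|p q f hpq hf].
- by apply: E_ext (E0 Omega) => z; rewrite mulr0.
- by apply: E_ext (E_add hf hg) => z; rewrite mulrDr.
- by apply: E_Hpq hpq _; apply: Hpq_scale.
Qed.

Lemma E_cLinfty (sigma : probability S R) Omega : E_ Omega `<=` cLp sigma +oo%E.
Proof.
apply: E_ind => [|f g hf hg|p q f _ /HpqP[P [_ _ ->]]].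
- exact: cLinfty_cst.
- exact: cLinftyD.
- exact: on_sphere_cLinfty.
Qed.

(* Since multiplication by a bounded function is weak*-continuous, only products
   of two harmonics matter. *)
Lemma algebra_pattern (sigma : probability S R) Omega :
  (forall p q p' q' f g, Omega (p, q) -> Omega (p', q') ->
     Hpq p q f -> Hpq p' q' g -> E_ Omega (fun z => f z * g z)) ->
  Linfty_algebra_pattern sigma Omega.
Proof.
move=> hM; apply: weak_star_closure_algebra; first exact: E_cLinfty.
split; [exact: E0|exact: E_add|exact: E_scale|].
move=> f Eg; move: f; apply: E_ind => [|f f' hf hf'|p q f hpq hf].
- by move=> _; apply: E_ext (E0 Omega) => z; rewrite mul0r.
- by move=> hg; apply: E_ext (E_add (hf hg) (hf' hg)) => z; rewrite mulrDl.
- move: Eg; apply: E_ind => [|g g' hg hg'|p' q' g hpq' hg].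
  + by apply: E_ext (E0 Omega) => z; rewrite mulr0.
  + by apply: E_ext (E_add hg hg') => z; rewrite mulrDr.
  + exact: hM hpq hpq' hf hg.
Qed.

End harmonic_spans.

Section pattern_closure.
Variables (R : realType) (m : nat).
Local Notation mp := (mpoly (m.+1 + m.+1) (R[i] : numFieldType)).
Local Notation zv := (@zv R[i] m.+1).
Local Notation wv := (@wv R[i] m.+1).
Implicit Types (P Q : mp).
Variable sigma : probability (borel_sphere R m) R.
Hypothesis sigma_inv : rotation_invariant sigma.
Variable Omega : set (nat * nat).
Hypothesis Omega_pattern : Linfty_algebra_pattern sigma Omega.
Local Notation L := (mean sigma).

(* If [(k, l)] is not in [Omega], then the weak*-closure is orthogonal to the
   highest weight vector [z_i^k conj(z_j)^l] of [H(k, l)]. *)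
Lemma pattern_product i j p q p' q' k l P Q : i != j ->
  Omega (p, q) -> bihom p q P -> lap P = 0 ->
  Omega (p', q') -> bihom p' q' Q -> lap Q = 0 ->
  L (P * Q * (zv j ^+ l * wv i ^+ k)) != 0 -> Omega (k, l).
Proof.
move=> ij hpq hP lP hpq' hQ lQ; apply: contra_neqP => hkl.
pose h : mp := zv j ^+ l * wv i ^+ k.
have inE p0 q0 F : Omega (p0, q0) -> bihom p0 q0 F -> lap F = 0 ->
    weak_star_closure sigma (E_ Omega) (on_sphere F).
  move=> hF0 hF lF; apply: subset_weak_star_closure; first exact: on_sphere_cLinfty.
  by apply: (E_Hpq hF0); apply/HpqP; exists F.
have [_ _ _ clM] := Omega_pattern.
have := clM _ _ (inE _ _ _ hpq hP lP) (inE _ _ _ hpq' hQ lQ).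
move/(weak_star_closure_orthogonal (on_sphere_cL1 sigma h)) => ortho.
rewrite -[RHS]ortho.
  by congr cintegral; apply/funext => z; rewrite /on_sphere !evalM.
move=> f _ Ef; suff [] : cLp sigma +oo%E f /\
  cintegral sigma (fun z => f z * on_sphere h z) = 0 by [].
move: f Ef; apply: E_ind => [|f g [bf ef] [bg eg]|p0 q0 f hF0 /HpqP[F [hF lF ->]]];
  (split; first by [exact: cLinfty_cst|exact: cLinftyD|exact: on_sphere_cLinfty]).
- rewrite -[RHS](cintegral_cst sigma); congr cintegral; apply/funext => z.
  by rewrite mul0r.
- have hh := on_sphere_cL1 sigma h.
  rewrite -[RHS]addr0 -[in X in _ = X + _]ef -[in X in _ = _ + X]eg.
  rewrite -cintegralD; [|exact: cL1M..].
  by congr cintegral; apply/funext => z; rewrite mulrDl.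
- have <- : L (F * h) = 0; last first.
    by congr cintegral; apply/funext => z; rewrite /on_sphere !evalM.
  apply: (functional_orthogonal (meanD sigma) (meanZ sigma) (mean_sqr_radius sigma)
    (mean_derivation sigma_inv) ij hF lF).
  by move=> e; apply: hkl; rewrite -e.
Qed.

Section two_indices.
Variables i j : 'I_m.+1.
Hypothesis ij : i != j.

Lemma pattern_add p q p' q' :
  Omega (p, q) -> Omega (p', q') -> Omega ((p + p')%N, (q + q')%N).
Proof.
move=> h h'; apply: (pattern_product ij h _ _ h') (functional_top_neq0
    (meanD sigma) (meanZ sigma) (mean1 sigma) (mean_sqr_radius sigma)
    (mean_derivation sigma_inv) i j p q p' q').
- exact: bihom_zwXn.
- exact: lap_zwXn.
- exact: bihom_zwXn.
- exact: lap_zwXn.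
Qed.

Lemma pattern_lower p q b :
  Omega ((p + b)%N, (q + b)%N) -> Omega (b, b) -> Omega (p, q).
Proof.
move=> h h'; apply: (pattern_product ij h _ _ h') (functional_lower_neq0
    (meanD sigma) (meanZ sigma) (mean1 sigma) (mean_sqr_radius sigma)
    (mean_derivation sigma_inv) i j p q b).
- exact: bihom_zwXn.
- exact: lap_zwXn.
- exact: bihom_zwXn.
- by apply: lap_zwXn; rewrite eq_sym.
Qed.

Lemma pattern_twisted_sqr b : Omega (b.+1, b.+1) -> Omega ((b + b)%N, (b + b)%N).
Proof.
move=> h; apply: (pattern_product ij h _ _ h) (functional_twisted_sqr_neq0
    (meanD sigma) (meanZ sigma) (mean1 sigma) (mean_sqr_radius sigma)
    (mean_derivation sigma_inv) b ij).
- exact: bihom_twisted.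
- exact: lap_twisted.
- exact: bihom_twisted.
- exact: lap_twisted.
Qed.

Lemma pattern_twisted_up p q : p != q -> Omega (p, q) -> Omega (2, 2) ->
  Omega (p.+1, q.+1).
Proof.
move=> pq h h'; apply: (pattern_product ij h _ _ h') (functional_twisted_up_neq0
    (meanD sigma) (meanZ sigma) (mean1 sigma) (mean_sqr_radius sigma)
    (mean_derivation sigma_inv) ij pq).
- exact: bihom_zwXn.
- exact: lap_zwXn.
- exact: bihom_twisted.
- exact: lap_twisted.
Qed.

Lemma pattern_twisted_down p q : p != q -> Omega (p.+1, q.+1) -> Omega (2, 2) ->
  Omega (p, q).
Proof.
move=> pq h h'; apply: (pattern_product ij h _ _ h') (functional_twisted_down_neq0
    (meanD sigma) (meanZ sigma) (mean1 sigma) (mean_sqr_radius sigma)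
    (mean_derivation sigma_inv) ij pq).
- exact: bihom_zwXn.
- exact: lap_zwXn.
- exact: bihom_twisted.
- by apply: lap_twisted; rewrite eq_sym.
Qed.

End two_indices.

Lemma pattern_three (i j k : 'I_m.+1) a : i != j -> i != k -> j != k ->
  Omega (a.+1, a.+1) -> Omega (1, 1).
Proof.
move=> ij ik jk h; apply: (pattern_product ij h _ _ h) (functional_three_neq0
    (meanD sigma) (meanZ sigma) (mean1 sigma) (mean_sqr_radius sigma)
    (mean_derivation sigma_inv) i j k a).
- exact: bihom_zwXn.
- exact: lap_zwXn.
- exact: bihom_zww.
- exact: lap_zww.
Qed.

End pattern_closure.

Lemma in_GP (Sigma : set nat) p q :
  G Sigma (p, q) <-> p = q \/ exists2 k, Sigma k & p = (q + k)%N.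
Proof.
rewrite /G /Delta; split=> [[/= e|[k Sk /= e]]|[->|[k Sk ->]]].
- by left; lia.
- by right; exists k => //; lia.
- by left; rewrite /= subrr.
- by right; exists k => //=; lia.
Qed.

Lemma in_GstarP (Sigma : set nat) p q : additive_semigroup Sigma ->
  Gstar Sigma (p, q) <->
  (p = q /\ ~~ odd p) \/ exists2 k, Sigma k & p = (q + k)%N.
Proof.
move=> [Sigma_gt0 _]; rewrite /Gstar; split=> [[/in_GP[e|] ne]|].
- left; split => //; apply/negP => op; apply: ne; exists p => //.
  by rewrite -e.
- by right.
- move=> [[e ep]|[k Sk e]].
    split; first by apply/in_GP; left.
    by move=> [k ok [e1 _]]; move: ep; rewrite e1 ok.
  split; first by apply/in_GP; right; exists k.
  by move=> [l _ [e1 e2]]; have := Sigma_gt0 k Sk; lia.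
Qed.

Lemma union_of_rays (Omega : set (nat * nat)) :
  (forall p q, Omega (p, q) -> (q <= p)%N) ->
  (forall p q p' q', Omega (p, q) -> Omega (p', q') ->
     Omega ((p + p')%N, (q + q')%N)) ->
  (forall p q, (q < p)%N -> Omega (p, q) <-> Omega (p.+1, q.+1)) ->
  let Sigma := [set k | (0 < k)%N /\ Omega (k, 0)%N] in
  additive_semigroup Sigma /\
  forall p q, p <> q -> Omega (p, q) <-> exists2 k, Sigma k & p = (q + k)%N.
Proof.
move=> Omega_ge Omega_add Omega_step Sigma; split.
  split=> [k []//|k l [k0 Ok] [l0 Ol]]; split; first by lia.
  exact: (Omega_add _ _ _ _ Ok Ol).
have ray k q : (0 < k)%N -> Omega (k, 0)%N <-> Omega ((q + k)%N, q).
  move=> k0; elim: q => [//|q IH]; rewrite IH addSn; apply: Omega_step; lia.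
move=> p q pq; split=> [Opq|[k [k0 Ok] ->]]; last exact/(ray k q k0).
have := Omega_ge _ _ Opq => qp; exists (p - q)%N; last by lia.
split; first by lia.
by apply/(ray _ q); [lia|rewrite subnKC].
Qed.

Section dimension_two.
Variable R : realType.
Variable sigma : probability (borel_sphere R 1) R.

Lemma Gstar_pattern (Sigma : set nat) : additive_semigroup Sigma ->
  Linfty_algebra_pattern sigma (Gstar Sigma).
Proof.
move=> hS; apply: algebra_pattern => p q p' q' f g hpq hpq'.
move=> /HpqP[P [hP lP ->]] /HpqP[Q [hQ lQ ->]].
have e z : on_sphere (P * Q) z = on_sphere P z * on_sphere Q z by exact: evalM.
apply: (E_ext e).
have sphere_r (z : borel_sphere R 1) : eval_zzbar (sqr_radius R[i] 2) (set_val z) = 1.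
  by rewrite eval_sqr_radius; apply: (set_valP z).
have dec n (pr : pred 'I_n) (h : nat -> mpoly (2 + 2) (R[i] : numFieldType)) :
    P * Q = \sum_(j < n | pr j) sqr_radius R[i] 2 ^+ j * h j ->
    (forall j : 'I_n, pr j -> E_ (Gstar Sigma) (on_sphere (m := 1) (h j))) ->
    E_ (Gstar Sigma) (on_sphere (m := 1) (P * Q)).
  move=> ePQ hE; apply: E_ext (E_sum (index_enum _) hE) => z.
  rewrite ePQ /on_sphere eval_sum; apply: eq_bigr => j _.
  by rewrite evalM evalXn sphere_r expr1n mul1r.
have hPQ := bihomM hP hQ.
have component p0 q0 F : Gstar Sigma (p0, q0) -> bihom p0 q0 F -> lap F = 0 ->
    E_ (Gstar Sigma) (on_sphere (m := 1) F).
  by move=> hG hF lF; apply: (E_Hpq hG); apply/HpqP; exists F.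
have positive k : Sigma k -> (p + p' = q + q' + k)%N ->
    E_ (Gstar Sigma) (on_sphere (m := 1) (P * Q)).
  move=> Sk epq; have [h [hh eh]] := @harmonic_decomposition _ 2 _ _ _ isT hPQ.
  apply: (dec _ xpredT h eh) => j _; have [|hj lj] := hh j; first by rewrite -ltnS.
  apply: component hj lj; apply/(in_GstarP _ _ hS); right; exists k => //.
  by have := ltn_ord j; lia.
move: hpq hpq' => /(in_GstarP _ _ hS)[[pq ep]|[k Sk pq]]
  /(in_GstarP _ _ hS)[[pq' ep']|[l Sl pq']].
- subst q q'; have [||h [hh eh]] := even_harmonic_decomposition hPQ.
  + by rewrite oddD (negbTE ep) (negbTE ep').
  + rewrite antipodalM (harmonic_antipodal hP lP) (harmonic_antipodal hQ lQ).
    by rewrite -signr_odd -(signr_odd _ p') (negbTE ep) (negbTE ep') !expr0 !mul1r.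
  apply: (dec _ (fun j : 'I_(p + p').+1 => ~~ odd j) h eh) => j oj.
  have [|hj lj] := hh j; first by rewrite -ltnS.
  apply: component hj lj; apply/(in_GstarP _ _ hS); left; split => //.
  by rewrite (oddB (ltn_ord j : (j <= p + p')%N)) oddD (negbTE ep) (negbTE ep').
- by apply: (positive l) => //; lia.
- by apply: (positive k) => //; lia.
- by apply: (positive (k + l)%N); [apply: (proj2 hS)|lia].
Qed.

End dimension_two.

Theorem theorem4p11 (R : realType) (m : nat)
    (sigma : probability (borel_sphere R m) R)
    (sigma_inv : rotation_invariant sigma)
    (Omega : set (nat * nat))
    (Omega_pattern : Linfty_algebra_pattern sigma Omega)
    (Omega_ge : forall p q, Omega (p, q) -> (q <= p)%N)
    (Omega_diag : exists2 a, (0 < a)%N & Omega (a, a)) :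
  ((3 <= m.+1)%N ->
     exists2 Sigma, additive_semigroup Sigma & Omega = G Sigma) /\
  (m.+1 = 2%N ->
     (forall Sigma, additive_semigroup Sigma ->
        Linfty_algebra_pattern sigma (Gstar Sigma)) /\
     (exists2 Sigma, additive_semigroup Sigma &
        Omega = G Sigma \/ Omega = Gstar Sigma)).
Proof.
have [[|a] // _ Oa] := Omega_diag.
split=> [m2|m1].
- pose i : 'I_m.+1 := @Ordinal m.+1 0 isT.
  pose j : 'I_m.+1 := @Ordinal m.+1 1 (ltnW m2).
  pose k : 'I_m.+1 := @Ordinal m.+1 2 m2.
  have ij : i != j by []. have ik : i != k by []. have jk : j != k by [].
  have O11 := pattern_three sigma_inv Omega_pattern ij ik jk Oa.
  have Oadd := pattern_add sigma_inv Omega_pattern ij.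
  have Olow := pattern_lower sigma_inv Omega_pattern ij.
  have Ostep p q : Omega (p, q) <-> Omega (p.+1, q.+1).
    split=> [h|h]; first by have := Oadd _ _ _ _ h O11; rewrite !addn1.
    by apply: (Olow p q 1%N) => //; rewrite !addn1.
  have Od p : Omega (p, p).
    by elim: p => [|p IH]; [apply: (Olow 0 0 1)%N|apply: (Ostep _ _).1].
  have [hS ray] := union_of_rays Omega_ge Oadd (fun p q _ => Ostep p q).
  exists [set k | (0 < k)%N /\ Omega (k, 0)%N] => //.
  apply/seteqP; split=> -[p q] h.
    apply/in_GP; case: (eqVneq p q) => [->|/eqP pq]; first by left.
    by right; apply/ray.
  move: h => /in_GP; case: (eqVneq p q) => [-> //|/eqP pq [//|]].
  by move/ray; apply.
- have {}m1 : m = 1%N by case: m1. subst m.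
  split; first by move=> Sigma; apply: Gstar_pattern.
  have ij : (ord0 : 'I_2) != ord_max by [].
  have Oadd := pattern_add sigma_inv Omega_pattern ij.
  have Olow := pattern_lower sigma_inv Omega_pattern ij.
  have O22 : Omega (2, 2).
    apply: (Olow _ _ (a + a)%N).
      have -> : (2 + (a + a) = a.+1 + a.+1)%N by lia.
      exact: (Oadd _ _ _ _ Oa Oa).
    exact: (pattern_twisted_sqr sigma_inv Omega_pattern ij Oa).
  have Ostep p q : (q < p)%N -> Omega (p, q) <-> Omega (p.+1, q.+1).
    move=> qp; have pq : p != q by rewrite gtn_eqF.
    split=> h; first exact: (pattern_twisted_up sigma_inv Omega_pattern ij).
    exact: (pattern_twisted_down sigma_inv Omega_pattern ij).
  have Ostep2 p : Omega (p, p) <-> Omega (p.+2, p.+2).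
    split=> [h|h]; first by have := Oadd _ _ _ _ h O22; rewrite !addn2.
    by apply: (Olow p p 2%N) => //; rewrite !addn2.
  have O00 : Omega (0, 0)%N := (Ostep2 0%N).2 O22.
  have Opar p : Omega (p, p) <-> (odd p -> Omega (1, 1)%N).
    elim/ltn_ind: p => -[|[|p]] IH //=; first by split=> // h; apply: h.
    by rewrite -Ostep2 negbK; apply: IH; rewrite leqW.
  have [hS ray] := union_of_rays Omega_ge Oadd Ostep.
  exists [set k | (0 < k)%N /\ Omega (k, 0)%N] => //.
  case: (pselect (Omega (1, 1)%N)) => O11; [left|right];
    apply/seteqP; split=> -[p q] h.
  + apply/in_GP; case: (eqVneq p q) => [->|/eqP pq]; first by left.
    by right; apply/ray.
  + move: h => /in_GP; case: (eqVneq p q) => [-> _|/eqP pq [//|]].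
      exact/Opar.
    by move/ray; apply.
  + apply/in_GstarP => //; case: (eqVneq p q) => [e|/eqP pq].
      subst q; left; split => //; apply/negP => op; apply: O11.
      by move/Opar: h; apply.
    by right; apply/ray.
  + move: h => /in_GstarP -/(_ hS); case: (eqVneq p q) => [e|/eqP pq].
      subst q; case=> [[_ ep]|[k [k0 _] e]]; last by lia.
      by apply/Opar; rewrite (negbTE ep).
    by case=> [[]//|]; move/ray; apply.
Qed.
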